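(* Let $(\boldsymbol{\tau}_h,\boldsymbol{v}_h)$, with $\boldsymbol{\tau}_h(\cdot,t)\in V_h(\Omega_h)^7$ and $\boldsymbol{v}_h(\cdot,t)\in V_h(\Omega_h)^6$ differentiable in $t$, satisfy the semi-discrete DG formulation below with $\boldsymbol f=0$, penalty parameters $\alpha_{\boldsymbol\tau},\alpha_{\boldsymbol v}\ge 0$ (piecewise constant on faces), free-surface boundary conditions on $\Gamma_{\boldsymbol\tau}$ and absorbing boundary conditions on $\Gamma_{\mathrm{abc}}$. Then \[ \frac12\frac{d}{dt}\sum_{D^k\in\Omega_h}\Big((\boldsymbol Q_s\boldsymbol\tau_h,\boldsymbol\tau_h)_{L^2(D^k)}+(\boldsymbol Q_v\boldsymbol v_h,\boldsymbol v_h)_{L^2(D^k)}\Big) = -\sum_{f\in\Gamma_h\setminus\partial\Omega}\int_f\Big(\tfrac{\alpha_{\boldsymbol\tau}}{2}|\boldsymbol A_n^T[\![\boldsymbol\tau_h]\!]|^2+\tfrac{\alpha_{\boldsymbol v}}{2}|\boldsymbol A_n[\![\boldsymbol v_h]\!]|^2\Big)\,d\boldsymbol x -\sum_{f\in\Gamma_{\boldsymbol\tau}}\int_f \alpha_{\boldsymbol\tau}|\boldsymbol A_n^T\boldsymbol\tau_h^-|^2\,d\boldsymbol x -\sum_{f\in\Gamma_{\mathrm{abc}}}\int_f\Big(\tfrac{\alpha_{\boldsymbol\tau}}{2}|\boldsymbol A_n^T\boldsymbol\tau_h^-|^2+\tfrac{\alpha_{\boldsymbol v}}{2}|\boldsymbol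 A_n\boldsymbol v_h^-|^2\Big)\,d\boldsymbol x +\sum_{D^k\in\Omega_h}\int_{D^k}\boldsymbol v_h^T\boldsymbol D\boldsymbol v_h\,d\boldsymbol x\;\le\;0 . \]
   Context: Setting (3D poroelasticity, first-order stress–velocity form). The unknowns are $\boldsymbol\tau=(\tau_{11},\tau_{22},\tau_{33},\tau_{23},\tau_{13},\tau_{12},p)^T$ and $\boldsymbol v=(v_1,v_2,v_3,q_1,q_2,q_3)^T$. $\boldsymbol Q_s(\boldsymbol x)\in\mathbb R^{7\times7}$ and $\boldsymbol Q_v(\boldsymbol x)\in\mathbb R^{6\times6}$ are symmetric, pointwise positive definite, uniformly bounded with uniformly bounded inverses (material matrices). $\boldsymbol D=\mathrm{diag}(0,0,0,-\eta/\kappa_1,-\eta/\kappa_2,-\eta/\kappa_3)$ with $\eta\ge0$, $\kappa_i>0$, so $\boldsymbol D$ is negative semi-definite. For a unit normal $\boldsymbol n=(n_x,n_y,n_z)$, $\boldsymbol A_n=\sum_i n_i\boldsymbol A_i$ is the $7\times6$ matrix with rows $(n_x,0,0,0,0,0)$, $(0,n_y,0,0,0,0)$, $(0,0,n_z,0,0,0)$, $(0,n_z,n_y,0,0,0)$, $(n_z,0,n_x,0,0,0)$, $(n_y,n_x,0,0,0,0)$, $(0,0,0,-n_x,-n_y,-n_z)$; the constant matrices $\boldsymbol A_1,\boldsymbol A_2,\boldsymbol A_3$ are obtained by taking $\boldsymbol n$ equal to the three coordinate unit vectors. Mesh and spaces: $\Omega$ is exactly triangulated by a mesh $\Omega_h$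 of elements $D^k$, each the image of a reference simplex under an affine map; $V_h(\Omega_h)$ is the space of functions whose restriction to each $D^k$ is a polynomial of total degree $\le N$. $\Gamma_h$ is the set of faces; $\Gamma_{\boldsymbol\tau}$ and $\Gamma_{\mathrm{abc}}$ partition the boundary faces. On a face $f$ of $D^k$ with outward unit normal $\boldsymbol n$, $u^-$ is the trace from $D^k$ and $u^+$ the trace from the neighbor; $[\![u]\!]=u^+-u^-$, $\{\!\{u\}\!\}=(u^++u^-)/2$, componentwise for vectors. On boundary faces the jumps are defined as: on $\Gamma_{\boldsymbol\tau}$ (free surface) $\boldsymbol A_n^T[\![\boldsymbol\tau]\!]:=-2\boldsymbol A_n^T\boldsymbol\tau^-$ and $[\![\boldsymbol v]\!]:=0$; on $\Gamma_{\mathrm{abc}}$ (absorbing) $\boldsymbol A_n^T[\![\boldsymbol\tau]\!]:=-\boldsymbol A_n^T\boldsymbol\tau^-$ and $[\![\boldsymbol v]\!]:=-\boldsymbol v^-$. DG formulation: for all $\boldsymbol h\in V_h(\Omega_h)^7$, $\boldsymbol g\in V_h(\Omega_h)^6$, $\sum_k(\boldsymbol Q_s\partial_t\boldsymbol\tau,\boldsymbol h)_{L^2(D^k)}=\sum_k\big[(\sum_{i=1}^3\boldsymbol A_i\partial_{x_i}\boldsymbol v,\boldsymbol h)_{L^2(D^k)}+\langle\tfrac12\boldsymbol A_n[\![\boldsymbol v]\!]+\tfrac{\alpha_{\boldsymbol\tau}}2\boldsymbol A_n\boldsymbol A_n^T[\![\boldsymbol\tau]\!],\boldsymbol h\rangle_{L^2(\partial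 D^k)}\big]$, $\sum_k(\boldsymbol Q_v\partial_t\boldsymbol v,\boldsymbol g)_{L^2(D^k)}=\sum_k\big[(\sum_{i=1}^3\boldsymbol A_i^T\partial_{x_i}\boldsymbol\tau+\boldsymbol f,\boldsymbol g)_{L^2(D^k)}+\langle\tfrac12\boldsymbol A_n^T[\![\boldsymbol\tau]\!]+\tfrac{\alpha_{\boldsymbol v}}2\boldsymbol A_n^T\boldsymbol A_n[\![\boldsymbol v]\!],\boldsymbol g\rangle_{L^2(\partial D^k)}+(\boldsymbol D\boldsymbol v,\boldsymbol g)_{L^2(D^k)}\big]$, where $(\cdot,\cdot)_{L^2(D^k)}$ and $\langle\cdot,\cdot\rangle_{L^2(\partial D^k)}$ are the $L^2$ inner products of vector functions on $D^k$ and on its boundary. *)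

(* Defs.v *)
From HB Require Import structures.
From mathcomp Require Import all_boot all_order all_algebra.
From mathcomp Require Import all_classical all_reals all_analysis.
Set Implicit Arguments. Unset Strict Implicit. Unset Printing Implicit Defensive.
Import Order.TTheory GRing.Theory Num.Theory.
Import numFieldNormedType.Exports.
Local Open Scope classical_set_scope.
Local Open Scope ring_scope.

Section DGdefs.
Variable R : realType.

Definition pt := 'rV[R]_3.
Definition cx (x : pt) := x ord0 (inord 0).
Definition cy (x : pt) := x ord0 (inord 1).
Definition cz (x : pt) := x ord0 (inord 2).

Definition dotv n (u w : 'cV[R]_n) : R := \sum_j u j ord0 * w j ord0.
Definition sqn n (u : 'cV[R]_n) : R := dotv u u.

Definition An (n : pt) : 'M[R]_(7, 6) :=
  \matrix_(i < 7, j < 6)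
    match nat_of_ord i, nat_of_ord j with
    | 0, 0 => cx n | 1, 1 => cy n | 2, 2 => cz n
    | 3, 1 => cz n | 3, 2 => cy n
    | 4, 0 => cz n | 4, 2 => cx n
    | 5, 0 => cy n | 5, 1 => cx n
    | 6, 3 => - cx n | 6, 4 => - cy n | 6, 5 => - cz n
    | _, _ => 0
    end.

Definition evec (i : 'I_3) : pt := delta_mx ord0 i.
Definition Ai (i : 'I_3) : 'M[R]_(7, 6) := An (evec i).

Definition Dmat (eta : R) (kappa : 'I_3 -> R) : 'M[R]_6 :=
  \matrix_(i < 6, j < 6)
    if (i == j) && (3 <= i)%N then - (eta / kappa (inord (i - 3))) else 0.

Definition midx (N : nat) := {ffun 'I_3 -> 'I_N.+1}.
Definition mdeg N (a : midx N) : nat := (\sum_i (a i : nat))%N.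
Definition monom N (a : midx N) (x : pt) : R := \prod_i x ord0 i ^+ a i.
Definition polyV N m (c : midx N -> 'cV[R]_m) (x : pt) : 'cV[R]_m :=
  \sum_(a : midx N | (mdeg a <= N)%N) monom a x *: c a.

Definition lebR := @lebesgue_measure R.
Definition leb3 := ((lebR \x lebR) \x lebR)%E.
Definition leb2 := (lebR \x lebR)%E.
Definition tet_ref : set ((R * R) * R) :=
  [set p | 0 <= p.1.1 /\ 0 <= p.1.2 /\ 0 <= p.2 /\ p.1.1 + p.1.2 + p.2 <= 1].
Definition tet_ref_int : set ((R * R) * R) :=
  [set p | 0 < p.1.1 /\ 0 < p.1.2 /\ 0 < p.2 /\ p.1.1 + p.1.2 + p.2 < 1].
Definition tri_ref : set (R * R) :=
  [set p | 0 <= p.1 /\ 0 <= p.2 /\ p.1 + p.2 <= 1].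
Definition pt_of (p : (R * R) * R) : pt :=
  \row_(c < 3) nth 0 [:: p.1.1; p.1.2; p.2] c.

Definition crossp (u w : pt) : pt :=
  \row_(c < 3) nth 0 [:: cy u * cz w - cz u * cy w;
                         cz u * cx w - cx u * cz w;
                         cx u * cy w - cy u * cx w] c.
Definition dotp (u w : pt) : R := \sum_c u ord0 c * w ord0 c.
Definition normp (u : pt) : R := Num.sqrt (dotp u u).

(* a local face of an element is either an interior face shared with the
   local face j of a neighbouring element k', or a boundary face lying on
   the free surface Gamma_tau, or on the absorbing boundary Gamma_abc *)
Inductive fkind (K : finType) := FInt of K & 'I_4 | FFree | FAbs.

Definition is_free K (f : fkind K) := if f is FFree then true else false.
Definition is_abs K (f : fkind K) := if f is FAbs then true else false.
Definition is_int K (f : fkind K) := if f is FInt _ _ then true else false.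

Section Mesh.
Variables (K : finType) (P : K -> 'I_4 -> pt) (nb : K -> 'I_4 -> fkind K).

(* affine map of the reference tetrahedron onto D^k (vertices P k 0..3) *)
Definition vmap (k : K) (p : (R * R) * R) : pt :=
  P k 0 + p.1.1 *: (P k 1 - P k 0) + p.1.2 *: (P k 2 - P k 0)
        + p.2 *: (P k 3 - P k 0).
Definition jac (k : K) : R :=
  \det (\matrix_(r < 3, c < 3) (P k (lift ord0 r) - P k ord0) ord0 c).
(* L^2(D^k) integral (change of variables from the reference element) *)
Definition vint (k : K) (g : pt -> R) : R :=
  `|jac k| * Rintegral leb3 tet_ref (fun p => g (vmap k p)).

(* local face i of D^k: the face opposite to vertex i *)
Definition fvert (k : K) (i : 'I_4) (m : 'I_3) : pt := P k (lift i m).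
Definition fmap (k : K) (i : 'I_4) (p : R * R) : pt :=
  fvert k i 0 + p.1 *: (fvert k i 1 - fvert k i 0)
              + p.2 *: (fvert k i 2 - fvert k i 0).
Definition fcross (k : K) (i : 'I_4) : pt :=
  crossp (fvert k i 1 - fvert k i 0) (fvert k i 2 - fvert k i 0).
Definition fint (k : K) (i : 'I_4) (g : pt -> R) : R :=
  normp (fcross k i) * Rintegral leb2 tri_ref (fun p => g (fmap k i p)).
(* outward unit normal of face i of D^k (pointing away from vertex i) *)
Definition normal (k : K) (i : 'I_4) : pt :=
  (- (Num.sg (dotp (fcross k i) (P k i - fvert k i 0)) / normp (fcross k i)))
    *: fcross k i.

Definition conforming_mesh : Prop :=
  [/\ (forall k, jac k != 0),
      (forall k k', k != k' ->
          (vmap k @` tet_ref_int) `&` (vmap k' @` tet_ref_int) = set0),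
      (forall k i k' j, nb k i = FInt k' j ->
          [/\ k' != k, nb k' j = FInt k i,
              range (fvert k i) = range (fvert k' j)
            & normal k' j = - normal k i]) &
      (forall k i, ~~ is_int (nb k i) ->
          forall k' j, (k', j) != (k, i) ->
            range (fvert k i) <> range (fvert k' j))].

Definition face_param (alpha : K -> 'I_4 -> R) : Prop :=
  (forall k i, 0 <= alpha k i) /\
  (forall k i k' j, nb k i = FInt k' j -> alpha k' j = alpha k i).

(* representative of each interior face (counted once) *)
Definition int_rep (k : K) (i : 'I_4) : bool :=
  if nb k i is FInt k' j then (enum_rank (k, i) < enum_rank (k', j))%N
  else false.

(* A_n^T [[tau]] on face i of D^k, with the boundary conventions *)
Definition jAtau (tau : K -> pt -> 'cV[R]_7) (k : K) (i : 'I_4) (x : pt)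
  : 'cV[R]_6 :=
  match nb k i with
  | FInt k' _ => (An (normal k i))^T *m (tau k' x - tau k x)
  | FFree => - (2 *: ((An (normal k i))^T *m tau k x))
  | FAbs => - ((An (normal k i))^T *m tau k x)
  end.
(* [[v]] on face i of D^k, with the boundary conventions *)
Definition jv (v : K -> pt -> 'cV[R]_6) (k : K) (i : 'I_4) (x : pt)
  : 'cV[R]_6 :=
  match nb k i with
  | FInt k' _ => v k' x - v k x
  | FFree => 0
  | FAbs => - v k x
  end.

End Mesh.

Definition ddt m (f : R -> 'cV[R]_m) (t : R) : 'cV[R]_m := derive f t 1.
Definition dxi m (f : pt -> 'cV[R]_m) (i : 'I_3) (x : pt) : 'cV[R]_m :=
  derive f x (evec i).

End DGdefs.

(* Main.v *)
Require Import Defs.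
From HB Require Import structures.
From mathcomp Require Import all_boot all_order all_algebra.
From mathcomp Require Import all_classical all_reals all_analysis.
From mathcomp Require Import measurable_realfun.
From mathcomp Require Import ring lra.
Import Order.TTheory GRing.Theory Num.Theory.
Import numFieldNormedType.Exports.
Local Open Scope classical_set_scope.
Local Open Scope ring_scope.
Set Implicit Arguments.
Unset Strict Implicit.
Unset Printing Implicit Defensive.

(* Test the scheme with (tau_h, v_h) itself.  By symmetry of Q_s and Q_v the
   left-hand sides add up to dE/dt.  On each element the two volume terms are
   the integral of sum_i d_i (tau^T A_i v), which the divergence theorem turns
   into the boundary integral of tau^T A_n v.  Across an interior face n changes
   sign, so the consistent parts of the two one-sided fluxes cancel and only the
   penalty dissipation survives; on boundary faces the jump conventions give the
   stated squares.

   All integrands other than those involving Q_s and Q_v are polynomials.  The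
   divergence theorem and the independence of a face integral of the numbering
   of the vertices are therefore read off, monomial by monomial, from Dirichlet's
   formula  a! b! c! / (a + b + c + d)!  for the integral of a monomial over the
   reference triangle (d = 2, in barycentric coordinates) or over the reference
   tetrahedron (d = 3), whose value is visibly symmetric in a, b, c. *)

(** * Monomial integrals on the reference simplices *)

(** The material matrices are only bounded and measurable, so [E] is not differentiated under the
    integral sign. On each element the energy is a quadratic form in finitely many polynomial
    coefficients, with weights independent of time, and the product rule on a finite sum suffices.
    Element and face integrals are reference integrals times the constants [|jac|] and
    [normp (fcross ..)], which turns geometry into algebra: a normal times its area factor is a
    cross product up to the sign of [jac], and the area vectors of a tetrahedron sum to zero. The
    price is that two neighbours may parametrise their common face by different vertex orders. That
    their integrals over it agree needs a proof: the area factors agree because renumbering changes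
    a cross product by at most a sign, the reference integrals because barycentric coordinates may
    be permuted. *)

Section RefIntegrals.
Variable R : realType.
Local Notation R1 := (measurableTypeR R).

Definition mu1 : {sigma_finite_measure set R1 -> \bar R} := @lebesgue_measure R.
(* The library's instance for products of subprobabilities hides the
   sigma-finite one on [\x], so it is declared again on this alias. *)
Definition mu2 := (mu1 \x mu1)%E.
HB.instance Definition _ := Measure.on mu2.

Lemma mu2_sigma_finite : sigma_finite setT mu2.
Proof.
exists (fun n => `[(- n%:R)%R, n%:R] `*` `[(- n%:R)%R, n%:R]); last first.
  move=> n; split; first exact: measurableX.
  rewrite /mu2 product_measure1E// /mu1 /= !lebesgue_measure_itv/=.
  by case: ifPn => _; rewrite ?mul0e // -EFinB -EFinM ltry.
apply/seteqP; split=> // -[x y] _.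
have [n hn] : exists n : nat, `|x| + `|y| <= n%:R.
  exists (Num.bound (`|x| + `|y|)); apply: ltW.
  by have := archi_boundP (addr_ge0 (normr_ge0 x) (normr_ge0 y)).
exists n => //=; have := normr_ge0 x; have := normr_ge0 y.
rewrite !in_itv/= -!ler_norml => ? ?; split; lra.
Qed.

HB.instance Definition _ :=
  Measure_isSigmaFinite.Build _ _ _ mu2 mu2_sigma_finite.

Definition mu3 := (mu2 \x mu1)%E.
HB.instance Definition _ := Measure.on mu3.

(** [e] is the dimension. For [e = 1] and [a = 0] this is Euler's Beta integral in [b], [c]; for
    [e = 3] the fourth barycentric coordinate has exponent 0. *)
Definition dirichlet (e a b c : nat) : R :=
  (a`! * b`! * c`!)%:R / (a + b + c + e)`!%:R.

(** Integration by parts as a polynomial identity: a factor [s - 'X] is traded for a factor ['X],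
    and the boundary term vanishes at 0 and at [s]. *)
Lemma beta_antiderivative (s : R) (b c : nat) : exists F : {poly R},
  [/\ deriv F = 'X^b * (s%:P - 'X) ^+ c, F.[0] = 0 &
      F.[s] = s ^+ (b + c).+1 * dirichlet 1 0 b c].
Proof.
rewrite /dirichlet fact0 mul1n add0n addn1; elim: c b => [|c IH] b.
  have b0 : (b.+1%:R : R) != 0 by rewrite pnatr_eq0.
  exists (b.+1%:R^-1 *: 'X^(b.+1)); split.
  - rewrite derivZ derivXn /= expr0 mulr1 -[X in _ *: X]scaler_nat scalerA.
    by rewrite mulVf ?scale1r.
  - by rewrite hornerZ hornerXn expr0n mulr0.
  - rewrite hornerZ hornerXn addn0 fact0 muln1 factS natrM.
    have f0 : (b`!%:R : R) != 0 by rewrite pnatr_eq0 -lt0n fact_gt0.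
    by rewrite invfM [b`!%:R * _]mulrCA mulfV// mulr1 mulrC.
have [F [dF F0 Fs]] := IH b.+1.
have b0 : (b.+1%:R : R) != 0 by rewrite pnatr_eq0.
exists (b.+1%:R^-1 *: ('X^(b.+1) * (s%:P - 'X) ^+ c.+1)
        + (c.+1%:R / b.+1%:R) *: F); split.
- rewrite derivD !derivZ dF derivM derivXn deriv_exp /= derivB derivC derivX.
  rewrite sub0r mulN1r mulrnAl mulrnAr mulrN.
  set q := s%:P - 'X.
  rewrite -(scaler_nat b.+1 ('X^b * _)) -(scaler_nat c.+1 (- _)).
  by rewrite scalerDr !scalerA mulVf// scale1r scalerN [c.+1%:R / _]mulrC subrK.
- by rewrite hornerD !hornerZ F0 mulr0 addr0 hornerM hornerXn expr0n mul0r mulr0.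
- rewrite hornerD !hornerZ Fs hornerM hornerXn horner_exp hornerD hornerN.
  rewrite hornerX hornerC.
  rewrite subrr expr0n mulr0 mulr0 add0r addSnnS (factS c) (factS b).
  move: ((b + c.+1).+1`!) => D; rewrite !natrM.
  move: (b.+1%:R) (c.+1%:R) (b`!%:R) (c`!%:R) (D%:R^-1) (s ^+ _) b0.
  move=> B C f g h u b0.
  by field.
Qed.

Lemma integral_beta (s : R) (b c : nat) : 0 <= s ->
  (\int[mu1]_(y in `[0%R, s]) (y ^+ b * (s - y) ^+ c)%:E =
   (s ^+ (b + c).+1 * dirichlet 1 0 b c)%:E)%E.
Proof.
(* [continuous_FTC2] wants a nondegenerate interval; at [s = 0] both sides are 0. *)
rewrite le_eqVlt => /predU1P[<-|s0].
  by rewrite set_itv1 integral_set1 expr0n mul0r.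
have [F [dF F0 Fs]] := beta_antiderivative s b c.
have cF := @continuous_horner R F.
rewrite (@continuous_FTC2 _ _ (horner F)) ?Fs ?F0 ?sube0//.
- apply: continuous_subspaceT => x.
  have -> : (fun y => y ^+ b * (s - y) ^+ c) = horner (deriv F).
    by apply/funext => y; rewrite dF !hornerE.
  exact: continuous_horner.
- split.
  + by move=> x _; exact: derivable_horner.
  + exact/cvg_at_right_filter/cF.
  + exact/cvg_at_left_filter/cF.
- by move=> x _; rewrite -derivE dF !hornerE.
Qed.

Definition bary2 (a b c : nat) (p : R * R) : R :=
  p.1 ^+ a * p.2 ^+ b * (1 - p.1 - p.2) ^+ c.
Definition mon3 (a b c : nat) (p : (R * R) * R) : R :=
  p.1.1 ^+ a * p.1.2 ^+ b * p.2 ^+ c.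

Lemma measurable_tri_ref : measurable (@tri_ref R : set (R1 * R1)%type).
Proof.
have -> : @tri_ref R = (setT `&` [set p : R1 * R1 | (cst 0 p : R) <= p.1])
   `&` (setT `&` [set p : R1 * R1 | (cst 0 p : R) <= p.2])
   `&` (setT `&` [set p : R1 * R1 | p.1 + p.2 <= (cst 1 p : R)]).
  by apply/seteqP; split=> -[x y] /=; rewrite /tri_ref/= => *; intuition.
apply: measurableI; first apply: measurableI.
- by apply: measurable_fun_le.
- by apply: measurable_fun_le.
- by apply: measurable_fun_le => //; exact: measurable_funD.
Qed.

Lemma measurable_tet_ref : measurable (@tet_ref R : set ((R1 * R1) * R1)%type).
Proof.
have -> : @tet_ref R = (setT `&` [set p : (R1 * R1) * R1 | (cst 0 p : R) <= p.1.1])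
   `&` (setT `&` [set p : (R1 * R1) * R1 | (cst 0 p : R) <= p.1.2])
   `&` (setT `&` [set p : (R1 * R1) * R1 | (cst 0 p : R) <= p.2])
   `&` (setT `&` [set p : (R1 * R1) * R1 | p.1.1 + p.1.2 + p.2 <= (cst 1 p : R)]).
  by apply/seteqP; split=> -[[x y] z] /=; rewrite /tet_ref/= => *; intuition.
have m1 : measurable_fun setT (fun p : (R1 * R1) * R1 => p.1.1 : R).
  exact: (measurableT_comp measurable_fst measurable_fst).
have m2 : measurable_fun setT (fun p : (R1 * R1) * R1 => p.1.2 : R).
  exact: (measurableT_comp measurable_snd measurable_fst).
apply: measurableI; first apply: measurableI; first apply: measurableI.
- by apply: measurable_fun_le.
- by apply: measurable_fun_le.
- by apply: measurable_fun_le.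
- apply: measurable_fun_le => //; apply: measurable_funD => //.
  exact: measurable_funD.
Qed.
End RefIntegrals.

(** * Dirichlet's formula by slicing *)

Section DirichletFormula.
Variable R : realType.
Local Notation R1 := (measurableTypeR R).
Local Notation mu1 := (mu1 R).

Lemma measurable_funTS_EFin d (T : measurableType d) (D : set T) (f : T -> R1) :
  measurable_fun setT f -> measurable_fun D (fun x => (f x)%:E).
Proof. by move=> mf; apply/measurable_EFinP; exact: measurable_funTS. Qed.

Lemma measurable_restrict_EFin d (T : measurableType d) (D : set T) (f : T -> R1) :
  measurable D -> measurable_fun setT f ->
  measurable_fun setT ((fun x => (f x)%:E) \_ D).
Proof.
move=> mD mf; apply/(measurable_restrictT _ mD).
exact: measurable_funTS_EFin.
Qed.

Lemma measurable_bary2 a b c :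
  measurable_fun setT (@bary2 R a b c : (R1 * R1)%type -> R1).
Proof.
apply: measurable_funM; [apply: measurable_funM|]; apply: measurable_funX => //.
by apply: measurable_funB => //; apply: measurable_funB.
Qed.

Lemma measurable_mon3 a b c :
  measurable_fun setT (@mon3 R a b c : ((R1 * R1) * R1)%type -> R1).
Proof.
apply: measurable_funM; [apply: measurable_funM|]; apply: measurable_funX => //.
  exact: (measurableT_comp measurable_fst measurable_fst).
exact: (measurableT_comp measurable_snd measurable_fst).
Qed.

(** Slicing the triangle at [x]: the Beta integral over [[0, 1 - x]] leaves [(1 - x) ^+ (b + c).+1],
    hence a second Beta integrand in [x], and the factorial of [(b + c).+1] cancels. *)
Lemma dirichlet2E (a b c : nat) :
  dirichlet R 1 0 a (b + c).+1 * dirichlet R 1 0 b c = dirichlet R 2 a b c.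
Proof.
rewrite /dirichlet !fact0 !mul1n !add0n !addn1 addnS addn2 addnA.
have f0 : ((b + c).+1`!%:R : R) != 0 by rewrite pnatr_eq0 -lt0n fact_gt0.
move: ((a + b + c).+2`!) ((b + c).+1`!) f0 => g f f0; rewrite !natrM.
move: (f%:R : R) (g%:R^-1 : R) f0 => {}f {}g f0.
by move: (a`!%:R : R) (b`!%:R : R) (c`!%:R : R) => x y z; field.
Qed.

(** Slicing the tetrahedron over the triangle: integrating [z ^+ c] up to [1 - x - y] raises the
    exponent to [c.+1] at the cost of [1 / (c + 1)], the first factor. *)
Lemma dirichlet3E (a b c : nat) :
  dirichlet R 1 0 c 0 * dirichlet R 2 a b c.+1 = dirichlet R 3 a b c.
Proof.
rewrite /dirichlet fact0 mul1n muln1 add0n addn0 addn1 addn3.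
rewrite (_ : (a + b + c.+1 + 2 = (a + b + c).+3)%N); last by rewrite addn2 addnS.
rewrite (factS c); move: ((a + b + c).+3`!) => g; rewrite !natrM.
have f0 : (c`!%:R : R) != 0 by rewrite pnatr_eq0 -lt0n fact_gt0.
have c0 : (c.+1%:R : R) != 0 by rewrite pnatr_eq0.
move: (c.+1%:R : R) (g%:R^-1 : R) (c`!%:R : R) f0 c0 => f {}g h ? ?.
by move: (a`!%:R : R) (b`!%:R : R) => x y; field; apply/andP.
Qed.

Lemma integral_tri_ref (a b c : nat) :
  (\int[@leb2 R]_(p in @tri_ref R) (bary2 a b c p)%:E = (dirichlet R 2 a b c)%:E)%E.
Proof.
(* Tonelli's theorem concerns the full product space, so the integrand is extended by 0 outside the
   triangle. *)
rewrite integral_mkcond.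
set f := (X in integral _ _ X).
have mf : measurable_fun setT (f : (R1 * R1)%type -> _).
  exact: (measurable_restrict_EFin (@measurable_tri_ref R) (measurable_bary2 a b c)).
have f0 p : (0 <= f p)%E.
  rewrite /f patchE.
case: ifPn => // /set_mem [p1 [p2 p12]].
  by rewrite lee_fin !mulr_ge0// exprn_ge0//; lra.
rewrite [LHS](@fubini_tonelli1 _ _ _ _ _ mu1 mu1 f mf f0) /fubini_F.
transitivity (\int[mu1]_(x in `[0%R, 1%R]) ((x ^+ a * (1 - x) ^+ (b + c).+1) *
   dirichlet R 1 0 b c)%:E)%E; last first.
  under eq_integral do rewrite EFinM.
  rewrite ge0_integralZr//.
  - by rewrite integral_beta// expr1n mul1r -EFinM dirichlet2E.
  - apply: measurable_funTS_EFin; apply: measurable_funM.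
      exact: measurable_funX.
    by apply: measurable_funX; apply: measurable_funB.
  - move=> x; rewrite /= in_itv/= => /andP[x0 x1].
    by rewrite lee_fin mulr_ge0// exprn_ge0//; lra.
  - by rewrite lee_fin divr_ge0.
rewrite [RHS]integral_mkcond; apply: eq_integral => x _.
rewrite patchE mem_setE in_itv/=; case: ifPn => [/andP[x0 x1]|x01].
  transitivity (\int[mu1]_(y in `[0%R, (1 - x)%R])
    ((x ^+ a)%:E * (y ^+ b * ((1 - x) - y) ^+ c)%:E))%E.
    rewrite [RHS]integral_mkcond; apply: eq_integral => y _.
    rewrite /f !patchE mem_setE in_itv/=; congr (if _ then _ else _).
      apply/idP/andP => [/set_mem[_ [/= y0 xy]]|[y0 yx]]; first by split; lra.
      by apply/mem_set; split => //=; split => //; lra.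
    by rewrite /bary2/= -mulrA EFinM.
  rewrite ge0_integralZl//.
  - by rewrite integral_beta ?subr_ge0// -EFinM mulrA.
  - apply: measurable_funTS_EFin; apply: measurable_funM.
      exact: measurable_funX.
    by apply: measurable_funX; apply: measurable_funB.
  - move=> y; rewrite /= in_itv/= => /andP[y0 y1].
    by rewrite lee_fin mulr_ge0// exprn_ge0//; lra.
  - by rewrite lee_fin exprn_ge0.
(* For [x] outside [[0, 1]] the slice of the triangle is empty. *)
apply: integral0_eq => y _; rewrite /f patchE.
case: ifPn => // /set_mem [/= p1 [p2 p12]].
by exfalso; move/negP: x01; apply; apply/andP; split; lra.
Qed.

Lemma integral_tet_ref (a b c : nat) :
  (\int[@leb3 R]_(p in @tet_ref R) (mon3 a b c p)%:E = (dirichlet R 3 a b c)%:E)%E.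
Proof.
rewrite integral_mkcond.
set f := (X in integral _ _ X).
have mf : measurable_fun setT (f : ((R1 * R1) * R1)%type -> _).
  exact: (measurable_restrict_EFin (@measurable_tet_ref R) (measurable_mon3 a b c)).
have f0 p : (0 <= f p)%E.
  rewrite /f patchE.
case: ifPn => // /set_mem [p1 [p2 [p3 p12]]].
  by rewrite lee_fin !mulr_ge0// exprn_ge0//; lra.
rewrite [LHS](@fubini_tonelli1 _ _ _ _ _ (@mu2 R) mu1 f mf f0) /fubini_F.
transitivity (\int[@mu2 R]_(p in @tri_ref R) ((dirichlet R 1 0 c 0)%:E *
   (bary2 a b c.+1 p)%:E))%E; last first.
  rewrite ge0_integralZl//.
  - by rewrite integral_tri_ref -EFinM dirichlet3E.
  - exact: measurable_tri_ref.
  - exact: (measurable_funTS_EFin (measurable_bary2 _ _ _)).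
  - move=> p [p1 [p2 p12]].
    by rewrite lee_fin !mulr_ge0// exprn_ge0//; lra.
  - by rewrite lee_fin divr_ge0.
rewrite [RHS]integral_mkcond; apply: eq_integral => -[x y] _.
rewrite patchE; case: ifPn => [/set_mem[/= x0 [y0 xy]]|xy].
  (* The factor with exponent 0 gives the slice the form of [integral_beta]. *)
  transitivity (\int[mu1]_(z in `[0%R, (1 - x - y)%R])
    ((x ^+ a * y ^+ b)%:E * (z ^+ c * ((1 - x - y) - z) ^+ 0)%:E))%E.
    rewrite [RHS]integral_mkcond; apply: eq_integral => z _.
    rewrite /f !patchE mem_setE in_itv/=; congr (if _ then _ else _).
      apply/idP/andP => [/set_mem[_ [_ [/= z0 xz]]]|[z0 zx]]; first by split; lra.
      by apply/mem_set; split => //=; split => //=; split => //=; lra.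
    by rewrite /mon3/= expr0 mulr1 EFinM.
  rewrite ge0_integralZl//.
  - rewrite integral_beta; last lra.
    by rewrite addn0 -!EFinM /bary2/= mulrA; congr (_%:E); rewrite mulrC.
  - apply: measurable_funTS_EFin; apply: measurable_funM.
      exact: measurable_funX.
    by apply: measurable_funX; apply: measurable_funB.
  - move=> z; rewrite /= in_itv/= => /andP[z0 z1].
    by rewrite lee_fin mulr_ge0// exprn_ge0//; lra.
  - by rewrite lee_fin mulr_ge0// exprn_ge0.
apply: integral0_eq => z _; rewrite /f patchE.
case: ifPn => // /set_mem [/= p1 [p2 [p3 p12]]].
exfalso; move/negP: xy; apply; apply/mem_set; split => //=; split => //=.
by simpl in p1, p2, p3, p12; lra.
Qed.
End DirichletFormula.

(** * Bounded measurable functions as a source of integrability *)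

Section BoundedMeasurable.
Variables (R : realType) (d : measure_display) (T : measurableType d).
Local Notation R1 := (measurableTypeR R).
Implicit Types (D : set T) (f g : T -> R).

(** Unlike integrability, this is stable under products; on a domain of finite measure it implies
    integrability, so side conditions follow the shape of the integrand. *)
Definition bmf D f := measurable_fun setT (f : T -> R1) /\
  exists M : R, forall x, D x -> `|f x| <= M.

Lemma bmf_cst D (a : R) : bmf D (fun=> a).
Proof. by split; [exact: measurable_cst|exists `|a|]. Qed.

Lemma bmfD D f g : bmf D f -> bmf D g -> bmf D (fun x => f x + g x).
Proof.
move=> [mf [M hM]] [mg [N hN]]; split; first exact: measurable_funD.
exists (M + N) => x Dx; apply: (le_trans (ler_normD _ _)).
by rewrite lerD ?hM ?hN.
Qed.

Lemma bmfM D f g : bmf D f -> bmf D g -> bmf D (fun x => f x * g x).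
Proof.
move=> [mf [M hM]] [mg [N hN]]; split; first exact: measurable_funM.
by exists (M * N) => x Dx; rewrite normrM ler_pM ?hM ?hN.
Qed.

Lemma bmf_sum D (I : Type) (s : seq I) (P : pred I) (F : I -> T -> R) :
  (forall i, bmf D (F i)) -> bmf D (fun x => \sum_(i <- s | P i) F i x).
Proof.
move=> bF; elim: s => [|i s IH].
  by rewrite (_ : (fun _ => _) = fun=> 0); [exact: bmf_cst|
    apply/funext => x; rewrite big_nil].
rewrite (_ : (fun _ => _) = fun x =>
    (if P i then F i x else 0) + \sum_(j <- s | P j) F j x); last first.
  by apply/funext => x; rewrite big_cons; case: (P i); rewrite ?add0r.
by apply: bmfD => //; case: (P i) => //; exact: bmf_cst.
Qed.

Lemma bmfX D f n : bmf D f -> bmf D (fun x => f x ^+ n).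
Proof.
move=> bf; elim: n => [|n IH].
  by rewrite (_ : (fun _ => _) = fun=> 1); [exact: bmf_cst|
    apply/funext => x; rewrite expr0].
rewrite (_ : (fun _ => _) = fun x => f x * f x ^+ n); first exact: bmfM.
by apply/funext => x; rewrite exprS.
Qed.

Variables (mu : {measure set T -> \bar R}) (D : set T).
Hypotheses (mD : measurable D) (muD : (mu D < +oo)%E).

Lemma bmf_integrable f : bmf D f -> mu.-integrable D (EFin \o f).
Proof.
move=> [mf [M hM]]; apply: measurable_bounded_integrable => //.
  exact: measurable_funTS.
exists M; split; first exact: num_real.
by move=> x Mx y Dy /=; apply: (le_trans (hM y Dy)); exact: ltW.
Qed.

Lemma bmf_RintegralZ f (a : R) : bmf D f ->
  Rintegral mu D (fun x => a * f x) = a * Rintegral mu D f.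
Proof. by move=> bf; rewrite RintegralZl//; exact: bmf_integrable. Qed.

Lemma bmf_RintegralD f g : bmf D f -> bmf D g ->
  Rintegral mu D (fun x => f x + g x) = Rintegral mu D f + Rintegral mu D g.
Proof. by move=> bf bg; rewrite RintegralD//; exact: bmf_integrable. Qed.

Lemma bmf_Rintegral_sum (I : Type) (s : seq I) (P : pred I) (F : I -> T -> R) :
  (forall i, bmf D (F i)) ->
  Rintegral mu D (fun x => \sum_(i <- s | P i) F i x) =
  \sum_(i <- s | P i) Rintegral mu D (F i).
Proof.
move=> bF; elim: s => [|i s IH].
  rewrite big_nil (_ : (fun _ => _) = fun=> 0 * 0).
    by rewrite bmf_RintegralZ ?mul0r//; exact: bmf_cst.
  by apply/funext => x; rewrite big_nil mul0r.
rewrite big_cons -IH (_ : (fun x => \sum_(j <- i :: s | P j) F j x) = fun x =>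
    (if P i then F i x else 0) + \sum_(j <- s | P j) F j x); last first.
  by apply/funext => x; rewrite big_cons; case: (P i); rewrite ?add0r.
case: (P i); first by rewrite bmf_RintegralD//; exact: bmf_sum.
by congr Rintegral; apply/funext => x; rewrite add0r.
Qed.

End BoundedMeasurable.

Section ReferenceFunctionals.
Variable R : realType.
Local Notation R1 := (measurableTypeR R).
Local Notation itri := (Rintegral (@leb2 R) (@tri_ref R)).
Local Notation itet := (Rintegral (@leb3 R) (@tet_ref R)).

Definition btri (f : R * R -> R) := bmf (@tri_ref R : set (R1 * R1)%type) f.
Definition btet (f : (R * R) * R -> R) :=
  bmf (@tet_ref R : set ((R1 * R1) * R1)%type) f.

Lemma btri_fst : btri (fun p => p.1).
Proof.
split; first exact: measurable_fst.
by exists 1 => -[x y] [/= x0 [y0 xy]]; rewrite ler_norml; lra.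
Qed.

Lemma btri_snd : btri (fun p => p.2).
Proof.
split; first exact: measurable_snd.
by exists 1 => -[x y] [/= x0 [y0 xy]]; rewrite ler_norml; lra.
Qed.

Lemma btet_1 : btet (fun p => p.1.1).
Proof.
split; first exact: (measurableT_comp measurable_fst measurable_fst).
by exists 1 => -[[x y] z] [/= x0 [/= y0 [/= z0 xy]]]; rewrite ler_norml/=; lra.
Qed.

Lemma btet_2 : btet (fun p => p.1.2).
Proof.
split; first exact: (measurableT_comp measurable_snd measurable_fst).
by exists 1 => -[[x y] z] [/= x0 [/= y0 [/= z0 xy]]]; rewrite ler_norml/=; lra.
Qed.

Lemma btet_3 : btet (fun p => p.2).
Proof.
split; first exact: measurable_snd.
by exists 1 => -[[x y] z] [/= x0 [/= y0 [/= z0 xy]]]; rewrite ler_norml/=; lra.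
Qed.

(** The measure is Dirichlet's integral with all exponents 0. *)
Lemma leb2_tri_ref_fin : (@mu2 R (@tri_ref R) < +oo)%E.
Proof.
have /= := integral_tri_ref R 0 0 0.
under eq_integral do rewrite /bary2 !expr0 !mulr1.
rewrite (@integral_cst _ _ _ (@mu2 R)); last exact: measurable_tri_ref.
by rewrite mul1e => ->; rewrite ltry.
Qed.

Lemma leb3_tet_ref_fin : (@mu3 R (@tet_ref R) < +oo)%E.
Proof.
have /= := integral_tet_ref R 0 0 0.
under eq_integral do rewrite /mon3 !expr0 !mulr1.
rewrite (@integral_cst _ _ _ (@mu3 R)); last exact: measurable_tet_ref.
by rewrite mul1e => ->; rewrite ltry.
Qed.

Lemma itriZ f (a : R) : btri f -> itri (fun p => a * f p) = a * itri f.
Proof.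
exact: (bmf_RintegralZ (mu := @mu2 R) (@measurable_tri_ref R) leb2_tri_ref_fin).
Qed.

Lemma itriD f g : btri f -> btri g ->
  itri (fun p => f p + g p) = itri f + itri g.
Proof.
exact: (bmf_RintegralD (mu := @mu2 R) (@measurable_tri_ref R) leb2_tri_ref_fin).
Qed.

Lemma itri_sum (I : Type) (s : seq I) (P : pred I) F : (forall i, btri (F i)) ->
  itri (fun p => \sum_(i <- s | P i) F i p) = \sum_(i <- s | P i) itri (F i).
Proof.
exact: (bmf_Rintegral_sum (mu := @mu2 R) (@measurable_tri_ref R) leb2_tri_ref_fin).
Qed.

Lemma itetZ f (a : R) : btet f -> itet (fun p => a * f p) = a * itet f.
Proof.
exact: (bmf_RintegralZ (mu := @mu3 R) (@measurable_tet_ref R) leb3_tet_ref_fin).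
Qed.

Lemma itetD f g : btet f -> btet g ->
  itet (fun p => f p + g p) = itet f + itet g.
Proof.
exact: (bmf_RintegralD (mu := @mu3 R) (@measurable_tet_ref R) leb3_tet_ref_fin).
Qed.

Lemma itet_sum (I : Type) (s : seq I) (P : pred I) F : (forall i, btet (F i)) ->
  itet (fun p => \sum_(i <- s | P i) F i p) = \sum_(i <- s | P i) itet (F i).
Proof.
exact: (bmf_Rintegral_sum (mu := @mu3 R) (@measurable_tet_ref R) leb3_tet_ref_fin).
Qed.

Lemma itri_bary2 a b c : itri (bary2 a b c) = dirichlet R 2 a b c.
Proof. by rewrite /Rintegral integral_tri_ref. Qed.

Lemma itet_mon3 a b c : itet (mon3 a b c) = dirichlet R 3 a b c.
Proof. by rewrite /Rintegral integral_tet_ref. Qed.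

End ReferenceFunctionals.

(** * Divergence theorem on the reference tetrahedron *)

Section TriPoly.
Variable R : realType.
Local Notation itri := (Rintegral (@leb2 R) (@tri_ref R)).
Local Notation itet := (Rintegral (@leb3 R) (@tet_ref R)).

Definition mono3 (q : nat * nat * nat) (x y z : R) : R :=
  x ^+ q.1.1 * y ^+ q.1.2 * z ^+ q.2.

(** The witness list need not be reduced, so sums concatenate and products expand. The arguments are
    meant as barycentric coordinates on the triangle, the third being [1 - p.1 - p.2], or as
    Cartesian coordinates on the tetrahedron. *)
Definition tripoly (H : R -> R -> R -> R) :=
  exists s : seq (R * (nat * nat * nat)),
    forall x y z, H x y z = \sum_(q <- s) q.1 * mono3 q.2 x y z.

Lemma tripoly_ext H H' : (forall x y z, H x y z = H' x y z) ->
  tripoly H -> tripoly H'.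
Proof. by move=> e [s hs]; exists s => x y z; rewrite -e. Qed.

Lemma tripoly_cst (a : R) : tripoly (fun _ _ _ => a).
Proof.
by exists [:: (a, (0, 0, 0)%N)] => x y z;
  rewrite big_seq1 /mono3 !expr0 !mulr1.
Qed.

Lemma tripoly_x : tripoly (fun x _ _ => x).
Proof.
by exists [:: (1, (1, 0, 0)%N)] => x y z;
  rewrite big_seq1 /mono3 !expr0 !mulr1 mul1r expr1.
Qed.

Lemma tripoly_y : tripoly (fun _ y _ => y).
Proof.
by exists [:: (1, (0, 1, 0)%N)] => x y z;
  rewrite big_seq1 /mono3 !expr0 !mulr1 !mul1r expr1.
Qed.

Lemma tripoly_z : tripoly (fun _ _ z => z).
Proof.
by exists [:: (1, (0, 0, 1)%N)] => x y z;
  rewrite big_seq1 /mono3 !expr0 !mul1r expr1.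
Qed.

Lemma tripolyD H H' : tripoly H -> tripoly H' ->
  tripoly (fun x y z => H x y z + H' x y z).
Proof.
by move=> [s hs] [t ht]; exists (s ++ t) => x y z; rewrite big_cat hs ht.
Qed.

Lemma tripolyM H H' : tripoly H -> tripoly H' ->
  tripoly (fun x y z => H x y z * H' x y z).
Proof.
move=> [s hs] [t ht].
exists [seq (p.1 * q.1, (p.2.1.1 + q.2.1.1, p.2.1.2 + q.2.1.2, p.2.2 + q.2.2)%N)
         | p <- s, q <- t] => x y z.
rewrite hs ht big_allpairs_dep big_distrl /=; apply: eq_bigr => p _.
rewrite big_distrr /=; apply: eq_bigr => q _.
by rewrite /mono3 /= !exprD; ring.
Qed.

Lemma tripoly_sum (I : Type) (s : seq I) (P : pred I) H :
  (forall i, tripoly (H i)) ->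
  tripoly (fun x y z => \sum_(i <- s | P i) H i x y z).
Proof.
move=> hH; elim: s => [|i s IH].
  by apply: tripoly_ext (tripoly_cst 0) => x y z; rewrite big_nil.
apply: (@tripoly_ext (fun x y z => (if P i then H i x y z else 0) +
   \sum_(j <- s | P j) H j x y z)).
  by move=> x y z; rewrite big_cons; case: (P i); rewrite ?add0r.
by apply: tripolyD => //; case: (P i) => //; exact: tripoly_cst.
Qed.

Lemma tripoly_prod (I : Type) (s : seq I) (P : pred I) H :
  (forall i, tripoly (H i)) ->
  tripoly (fun x y z => \prod_(i <- s | P i) H i x y z).
Proof.
move=> hH; elim: s => [|i s IH].
  by apply: tripoly_ext (tripoly_cst 1) => x y z; rewrite big_nil.
apply: (@tripoly_ext (fun x y z => (if P i then H i x y z else 1) *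
   \prod_(j <- s | P j) H j x y z)).
  by move=> x y z; rewrite big_cons; case: (P i); rewrite ?mul1r.
by apply: tripolyM => //; case: (P i) => //; exact: tripoly_cst.
Qed.

Lemma tripolyX H n : tripoly H -> tripoly (fun x y z => H x y z ^+ n).
Proof.
move=> hH; apply: (@tripoly_ext (fun x y z => \prod_(i < n) H x y z)).
  by move=> x y z; rewrite big_const_ord iter_mulr mulr1.
exact: tripoly_prod.
Qed.

Lemma tripoly_comp H A B C : tripoly H -> tripoly A -> tripoly B -> tripoly C ->
  tripoly (fun x y z => H (A x y z) (B x y z) (C x y z)).
Proof.
move=> [s hs] hA hB hC; apply: (@tripoly_ext (fun x y z =>
  \sum_(q <- s) q.1 * mono3 q.2 (A x y z) (B x y z) (C x y z))) => //.
apply: tripoly_sum => q; apply: tripolyM; first exact: tripoly_cst.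
by apply: tripolyM; [apply: tripolyM|]; apply: tripolyX.
Qed.

Lemma tripoly_perm21 H : tripoly H -> tripoly (fun x y z => H y x z).
Proof.
by move=> hH; apply: tripoly_comp hH tripoly_y tripoly_x tripoly_z.
Qed.

Lemma tripoly_perm32 H : tripoly H -> tripoly (fun x y z => H x z y).
Proof.
by move=> hH; apply: tripoly_comp hH tripoly_x tripoly_z tripoly_y.
Qed.

Lemma tripoly_perm31 H : tripoly H -> tripoly (fun x y z => H z y x).
Proof.
by move=> hH; apply: tripoly_comp hH tripoly_z tripoly_y tripoly_x.
Qed.

Lemma bmf_tripoly d (T : measurableType d) (D : set T) (f g h : T -> R) H :
  bmf D f -> bmf D g -> bmf D h -> tripoly H ->
  bmf D (fun p => H (f p) (g p) (h p)).
Proof.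
move=> bf bg bh [s hs].
rewrite (_ : (fun _ => _) = fun p =>
  \sum_(q <- s) q.1 * mono3 q.2 (f p) (g p) (h p)); last exact/funext.
apply: bmf_sum => q; apply: bmfM; first exact: bmf_cst.
by apply: bmfM; [apply: bmfM|]; apply: bmfX.
Qed.

Lemma btri_thd : btri (fun p : R * R => 1 - p.1 - p.2).
Proof.
have bN f : btri f -> btri (fun p : R * R => - f p).
  move=> bf; rewrite (_ : (fun _ => _) = fun p => -1 * f p).
    by apply: bmfM => //; exact: bmf_cst.
  by apply/funext => p; rewrite mulN1r.
apply: bmfD; last exact/bN/btri_snd.
by apply: bmfD; [exact: bmf_cst|exact/bN/btri_fst].
Qed.

Lemma btri_tripoly H : tripoly H ->
  btri (fun p => H p.1 p.2 (1 - p.1 - p.2)).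
Proof. exact: (bmf_tripoly (btri_fst R) (btri_snd R) btri_thd). Qed.

Lemma btet_tripoly H : tripoly H -> btet (fun p => H p.1.1 p.1.2 p.2).
Proof. exact: (bmf_tripoly (btet_1 R) (btet_2 R) (btet_3 R)). Qed.

Lemma tripoly_mono3 q : tripoly (mono3 q).
Proof. by exists [:: (1, q)] => x y z; rewrite big_seq1 mul1r. Qed.

Definition dirw e (q : nat * nat * nat) := dirichlet R e q.1.1 q.1.2 q.2.

(** This reduces identities between integrals of polynomials to identities between factorials. *)
Lemma itri_mono3_sum (s : seq (R * (nat * nat * nat))) :
  itri (fun p => \sum_(q <- s) q.1 * mono3 q.2 p.1 p.2 (1 - p.1 - p.2)) =
  \sum_(q <- s) q.1 * dirw 2 q.2.
Proof.
have b q := btri_tripoly (tripoly_mono3 q).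
rewrite itri_sum => [|q]; last by apply: bmfM; [exact: bmf_cst|exact: b].
by apply: eq_bigr => q _; rewrite itriZ// itri_bary2.
Qed.

Lemma itet_mono3_sum (s : seq (R * (nat * nat * nat))) :
  itet (fun p => \sum_(q <- s) q.1 * mono3 q.2 p.1.1 p.1.2 p.2) =
  \sum_(q <- s) q.1 * dirw 3 q.2.
Proof.
have b q := btet_tripoly (tripoly_mono3 q).
rewrite itet_sum => [|q]; last by apply: bmfM; [exact: bmf_cst|exact: b].
by apply: eq_bigr => q _; rewrite itetZ// itet_mon3.
Qed.

Lemma itri_perm21 H : tripoly H ->
  itri (fun p => H p.2 p.1 (1 - p.1 - p.2)) =
  itri (fun p => H p.1 p.2 (1 - p.1 - p.2)).
Proof.
move=> [s hs].
transitivity (itri (fun p =>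
  \sum_(q <- [seq (q.1, (q.2.1.2, q.2.1.1, q.2.2)) | q <- s])
   q.1 * mono3 q.2 p.1 p.2 (1 - p.1 - p.2))).
  congr Rintegral; apply/funext => p; rewrite hs big_map.
  by apply: eq_bigr => q _; rewrite /mono3 /=; ring.
rewrite itri_mono3_sum big_map [in RHS](_ : (fun _ => _) = fun p =>
  \sum_(q <- s) q.1 * mono3 q.2 p.1 p.2 (1 - p.1 - p.2)); last exact/funext.
rewrite itri_mono3_sum; apply: eq_bigr => -[u [[a b] c]] _.
by rewrite /dirw /dirichlet /= (mulnC b`!) (addnC b).
Qed.

(** The dependent coordinate [1 - p.1 - p.2] takes part, so this is an affine symmetry of the
    triangle and not a mere swap of variables; on exponents it is still a transposition. *)
Lemma itri_perm32 H : tripoly H ->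
  itri (fun p => H p.1 (1 - p.1 - p.2) p.2) =
  itri (fun p => H p.1 p.2 (1 - p.1 - p.2)).
Proof.
move=> [s hs].
transitivity (itri (fun p =>
  \sum_(q <- [seq (q.1, (q.2.1.1, q.2.2, q.2.1.2)) | q <- s])
   q.1 * mono3 q.2 p.1 p.2 (1 - p.1 - p.2))).
  congr Rintegral; apply/funext => p; rewrite hs big_map.
  by apply: eq_bigr => q _; rewrite /mono3 /=; ring.
rewrite itri_mono3_sum big_map [in RHS](_ : (fun _ => _) = fun p =>
  \sum_(q <- s) q.1 * mono3 q.2 p.1 p.2 (1 - p.1 - p.2)); last exact/funext.
rewrite itri_mono3_sum; apply: eq_bigr => -[u [[a b] c]] _.
by rewrite /dirw /dirichlet /= (mulnAC a`! b`!) (addnAC a b).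
Qed.

(** The two transpositions above generate all permutations of the three coordinates. *)
Lemma itri_perm H : tripoly H ->
  let I := itri (fun p => H p.1 p.2 (1 - p.1 - p.2)) in
  [/\ itri (fun p => H p.2 (1 - p.1 - p.2) p.1) = I,
      itri (fun p => H (1 - p.1 - p.2) p.1 p.2) = I &
      itri (fun p => H (1 - p.1 - p.2) p.2 p.1) = I].
Proof.
move=> hH /=; have h32 := tripoly_perm32 hH; have h21 := tripoly_perm21 hH.
split.
- by rewrite (itri_perm21 h32) itri_perm32.
- by rewrite (itri_perm32 h21) itri_perm21.
- rewrite (itri_perm21 (tripoly_perm32 h21)).
  by rewrite (itri_perm32 h21) itri_perm21.
Qed.

End TriPoly.

(** * The fundamental theorem of calculus in each variable *)

Section RefDivergence.
Variable R : realType.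
Local Notation itri := (Rintegral (@leb2 R) (@tri_ref R)).
Local Notation itet := (Rintegral (@leb3 R) (@tet_ref R)).

Lemma itet_perm32 H : tripoly H ->
  itet (fun p => H p.1.1 p.2 p.1.2) = itet (fun p => H p.1.1 p.1.2 p.2).
Proof.
move=> [s hs].
transitivity (itet (fun p =>
  \sum_(q <- [seq (q.1, (q.2.1.1, q.2.2, q.2.1.2)) | q <- s])
   q.1 * mono3 q.2 p.1.1 p.1.2 p.2)).
  congr Rintegral; apply/funext => p; rewrite hs big_map.
  by apply: eq_bigr => q _; rewrite /mono3 /=; ring.
rewrite itet_mono3_sum big_map [in RHS](_ : (fun _ => _) = fun p =>
  \sum_(q <- s) q.1 * mono3 q.2 p.1.1 p.1.2 p.2); last exact/funext.
rewrite itet_mono3_sum; apply: eq_bigr => -[u [[a b] c]] _.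
by rewrite /dirw /dirichlet /= (mulnAC a`! b`!) (addnAC a b).
Qed.

Lemma itet_perm31 H : tripoly H ->
  itet (fun p => H p.2 p.1.2 p.1.1) = itet (fun p => H p.1.1 p.1.2 p.2).
Proof.
move=> [s hs].
transitivity (itet (fun p =>
  \sum_(q <- [seq (q.1, (q.2.2, q.2.1.2, q.2.1.1)) | q <- s])
   q.1 * mono3 q.2 p.1.1 p.1.2 p.2)).
  congr Rintegral; apply/funext => p; rewrite hs big_map.
  by apply: eq_bigr => q _; rewrite /mono3 /=; ring.
rewrite itet_mono3_sum big_map [in RHS](_ : (fun _ => _) = fun p =>
  \sum_(q <- s) q.1 * mono3 q.2 p.1.1 p.1.2 p.2); last exact/funext.
rewrite itet_mono3_sum; apply: eq_bigr => -[u [[a b] c]] _.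
rewrite /dirw /dirichlet /= (mulnC _ a`!) (addnC _ a) mulnA addnA.
by rewrite (mulnAC a`! b`!) (addnAC a b).
Qed.

(** At exponent 0 the predecessor is again 0, but then the factor [q.2%:R] annihilates the term. *)
Lemma is_derive_mono3 (u : R) q x y z :
  is_derive z (1 : R) (fun z => u * mono3 q x y z)
    (u * q.2%:R * mono3 (q.1, q.2.-1) x y z).
Proof.
set k := u * (x ^+ q.1.1 * y ^+ q.1.2).
rewrite (_ : (fun _ => _) = horner (k *: 'X^(q.2))); last first.
  by apply/funext => t; rewrite hornerZ hornerXn /mono3 mulrA.
apply: is_derive_eq; rewrite derivZ derivXn hornerZ hornerMn hornerXn -mulr_natl.
by rewrite /k /mono3 /=; ring.
Qed.

Lemma is_derive_mono3_sum (s : seq (R * (nat * nat * nat))) x y z :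
  is_derive z (1 : R) (fun z => \sum_(q <- s) q.1 * mono3 q.2 x y z)
    (\sum_(q <- s) q.1 * q.2.2%:R * mono3 (q.2.1, q.2.2.-1) x y z).
Proof.
elim: s => [|q s IH].
  rewrite big_nil (_ : (fun _ => _) = cst 0); first exact: is_derive_cst.
  by apply/funext => t; rewrite big_nil.
rewrite big_cons (_ : (fun _ => _) = (fun z => q.1 * mono3 q.2 x y z) +
   (fun z => \sum_(q <- s) q.1 * mono3 q.2 x y z)).
  by apply: is_deriveD => //; exact: is_derive_mono3.
by apply/funext => t; rewrite big_cons.
Qed.

(** The fundamental theorem in [z] for one monomial: the left side integrates its [z]-derivative
    over the tetrahedron, the right side is the slanted face minus the face [z = 0], where [0 ^+ c]
    keeps only [c = 0]. *)
Lemma dirichlet_pred (a b c : nat) :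
  c%:R * dirichlet R 3 a b c.-1 = dirichlet R 2 a b c - 0 ^+ c * dirichlet R 2 a b 0.
Proof.
case: c => [|c]; first by rewrite mul0r expr0 mul1r subrr.
rewrite exprS mul0r mul0r subr0 /dirichlet /= addn3.
rewrite (_ : (a + b + c.+1 + 2 = (a + b + c).+3)%N); last by rewrite addn2 addnS.
by rewrite mulrA -natrM (factS c) mulnCA.
Qed.

Lemma tripoly_ftc_z H : tripoly H -> exists H', [/\ tripoly H',
  forall x y z, is_derive z (1 : R) (H x y) (H' x y z) &
  itet (fun p => H' p.1.1 p.1.2 p.2) =
  itri (fun p => H p.1 p.2 (1 - p.1 - p.2)) - itri (fun p => H p.1 p.2 0)].
Proof.
move=> [s hs].
pose s' := [seq (q.1 * q.2.2%:R, (q.2.1, q.2.2.-1)) | q <- s].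
exists (fun x y z => \sum_(q <- s') q.1 * mono3 q.2 x y z); split.
- by exists s'.
- move=> x y z; rewrite big_map (_ : H x y =
      fun z => \sum_(q <- s) q.1 * mono3 q.2 x y z).
    exact: is_derive_mono3_sum.
  exact/funext.
rewrite itet_mono3_sum big_map.
rewrite (_ : (fun p => H p.1 p.2 (1 - p.1 - p.2)) =
  fun p => \sum_(q <- s) q.1 * mono3 q.2 p.1 p.2 (1 - p.1 - p.2)); last exact/funext.
rewrite (_ : (fun p => H p.1 p.2 0) = fun p =>
  \sum_(q <- [seq (q.1 * 0 ^+ q.2.2, (q.2.1, 0%N)) | q <- s])
   q.1 * mono3 q.2 p.1 p.2 (1 - p.1 - p.2)); last first.
  apply/funext => p; rewrite hs big_map; apply: eq_bigr => q _.
  by rewrite /mono3 /= expr0; ring.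
rewrite !itri_mono3_sum big_map -sumrB; apply: eq_bigr => -[u [[a b] c]] _.
by rewrite /dirw /= -mulrA dirichlet_pred mulrBr [u * (0 ^+ c * _)]mulrA.
Qed.

(** The directions [x] and [y] reduce to [z] by exchanging variables. Each direction meets the
    slanted face in its own parametrisation; [itri_perm] identifies them with [I0], the one that
    [fmap] uses for face 0. *)
Lemma tripoly_divergence H : tripoly H -> exists Hx Hy Hz,
  let I0 := itri (fun p => H (1 - p.1 - p.2) p.1 p.2) in
  [/\ [/\ tripoly Hx, tripoly Hy & tripoly Hz],
    [/\ forall x y z, is_derive x (1 : R) (fun x => H x y z) (Hx x y z),
        forall x y z, is_derive y (1 : R) (fun y => H x y z) (Hy x y z) &
        forall x y z, is_derive z (1 : R) (fun z => H x y z) (Hz x y z)] &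
    [/\ itet (fun p => Hx p.1.1 p.1.2 p.2) = I0 - itri (fun p => H 0 p.1 p.2),
        itet (fun p => Hy p.1.1 p.1.2 p.2) = I0 - itri (fun p => H p.1 0 p.2) &
        itet (fun p => Hz p.1.1 p.1.2 p.2) = I0 - itri (fun p => H p.1 p.2 0)]].
Proof.
move=> hH; have [pe1 pe2 pe3] := itri_perm hH.
have [Hx [hx dx ix]] := tripoly_ftc_z (tripoly_perm31 hH).
have [Hy [hy dy iy]] := tripoly_ftc_z (tripoly_perm32 hH).
have [Hz [hz dz iz]] := tripoly_ftc_z hH.
exists (fun x y z => Hx z y x), (fun x y z => Hy x z y), Hz; split.
- by split; [exact: tripoly_perm31|exact: tripoly_perm32|].
- by split => x y z; [exact: dx|exact: dy|exact: dz].
split.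
- rewrite (itet_perm31 hx) ix pe2 pe3; congr (_ - _).
  have h : tripoly (fun x y z => H 0 x y).
    by apply: tripoly_comp hH (tripoly_cst 0) (tripoly_x R) (tripoly_y R).
  exact: (itri_perm21 h).
- by rewrite (itet_perm32 hy) iy pe2 (itri_perm32 hH).
- by rewrite iz pe2.
Qed.
End RefDivergence.

(** * Divergence theorem and face integrals on an element *)

Section PolyPt.
Variable R : realType.
Implicit Types g : pt R -> R.

(* A polynomial function on R^3, seen through its restrictions to all affine
   parametrisations. *)
Definition polypt g :=
  (forall A B C D : pt R, tripoly (fun x y z => g (A + x *: B + y *: C + z *: D)))
  /\ (forall x, differentiable g x).

Lemma polypt_cst (a : R) : polypt (fun=> a).
Proof.
by split=> [A B C D|x]; [exact: tripoly_cst|exact: differentiable_cst].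
Qed.

Lemma polypt_coord i : polypt (fun x => x ord0 i).
Proof.
split=> [A B C D|x]; last exact: differentiable_coord.
apply: (@tripoly_ext _ (fun x y z => A ord0 i + x * B ord0 i + y * C ord0 i
    + z * D ord0 i)); first by move=> x y z; rewrite !mxE.
by do 3 (apply: tripolyD; last by apply: tripolyM; rewrite //;
  (exact: tripoly_cst||exact: tripoly_x||exact: tripoly_y||exact: tripoly_z));
  exact: tripoly_cst.
Qed.

Lemma polyptD f g : polypt f -> polypt g -> polypt (fun x => f x + g x).
Proof.
move=> [f1 f2] [g1 g2]; split=> [A B C D|x]; first exact: tripolyD.
exact: (differentiableD (f2 x) (g2 x)).
Qed.

Lemma polyptM f g : polypt f -> polypt g -> polypt (fun x => f x * g x).
Proof.
move=> [f1 f2] [g1 g2]; split=> [A B C D|x]; first exact: tripolyM.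
exact: (differentiableM (f2 x) (g2 x)).
Qed.

Lemma polyptZ (a : R) f : polypt f -> polypt (fun x => a * f x).
Proof. by move=> hf; apply: polyptM => //; exact: polypt_cst. Qed.

Lemma polypt_sum (I : Type) (s : seq I) (P : pred I) F :
  (forall i, polypt (F i)) -> polypt (fun x => \sum_(i <- s | P i) F i x).
Proof.
move=> hF; elim: s => [|i s IH].
  rewrite (_ : (fun _ => _) = fun=> 0); first exact: polypt_cst.
  by apply/funext => x; rewrite big_nil.
rewrite (_ : (fun _ => _) = fun x =>
    (if P i then F i x else 0) + \sum_(j <- s | P j) F j x); last first.
  by apply/funext => x; rewrite big_cons; case: (P i); rewrite ?add0r.
by apply: polyptD => //; case: (P i) => //; exact: polypt_cst.
Qed.

Lemma polypt_prod (I : Type) (s : seq I) (P : pred I) F :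
  (forall i, polypt (F i)) -> polypt (fun x => \prod_(i <- s | P i) F i x).
Proof.
move=> hF; elim: s => [|i s IH].
  rewrite (_ : (fun _ => _) = fun=> 1); first exact: polypt_cst.
  by apply/funext => x; rewrite big_nil.
rewrite (_ : (fun _ => _) = fun x =>
    (if P i then F i x else 1) * \prod_(j <- s | P j) F j x); last first.
  by apply/funext => x; rewrite big_cons; case: (P i); rewrite ?mul1r.
by apply: polyptM => //; case: (P i) => //; exact: polypt_cst.
Qed.

Lemma polyptX f n : polypt f -> polypt (fun x => f x ^+ n).
Proof.
move=> hf; rewrite (_ : (fun _ => _) = fun x => \prod_(i < n) f x).
  exact: polypt_prod.
by apply/funext => x; rewrite big_const_ord iter_mulr mulr1.
Qed.

Lemma polypt_polyV N m (c : midx N -> 'cV[R]_m) j :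
  polypt (fun x => polyV c x j ord0).
Proof.
rewrite (_ : (fun _ => _) = fun x =>
    \sum_(a : midx N | (mdeg a <= N)%N) monom a x * c a j ord0).
  apply: polypt_sum => a; apply: polyptM; last exact: polypt_cst.
  by apply: polypt_prod => i; exact: (polyptX (a i) (polypt_coord i)).
by apply/funext => x; rewrite /polyV summxE; apply: eq_bigr => a _; rewrite !mxE.
Qed.

(** The difference quotients coincide. This links a partial derivative of a pulled-back function
    with a directional derivative along an edge of the element. *)
Lemma derive_line (V : normedModType R) (g : V -> R) (f : R -> R)
    (a w : V) (x e : R) :
  (forall s, f s = g (a + s *: w)) -> is_derive x (1 : R) f e ->
  'D_w g (a + x *: w) = e.
Proof.
move=> /funext-> [_ <-].
have eq_quot : (fun h : R => h^-1 *: ((g \o shift (a + x *: w)) (h *: w)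
      - g (a + x *: w))) = (fun h => h^-1 *: (((fun s => g (a + s *: w)) \o shift x)
      (h *: (1 : R)) - g (a + x *: w))).
  apply/funext => h /=; congr (_ *: (g _ - _)).
  by rewrite [_ *: 1 + x]addrC scalerDl [h *: w + _]addrC -addrA [h *: 1]mulr1.
by rewrite /derive eq_quot.
Qed.

End PolyPt.

(** * Cross products and determinants in dimension three *)

Section Vectors.
Variable R : realType.
Implicit Types u w : pt R.

Lemma sum_ord3 (V : nmodType) (F : 'I_3 -> V) :
  \sum_(i < 3) F i = F 0 + F 1 + F 2.
Proof.
rewrite !big_ord_recl big_ord0 addr0 addrA.
by congr (F _ + F _ + F _); apply/val_inj.
Qed.

Lemma sum_ord4 (V : nmodType) (F : 'I_4 -> V) :
  \sum_(i < 4) F i = F 0 + F 1 + F 2 + F 3.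
Proof.
rewrite !big_ord_recl big_ord0 addr0 !addrA.
by congr (F _ + F _ + F _ + F _); apply/val_inj.
Qed.

Lemma cxE u : cx u = u ord0 0.
Proof. by congr (u _ _); apply/val_inj; rewrite /= inordK. Qed.
Lemma cyE u : cy u = u ord0 1.
Proof. by congr (u _ _); apply/val_inj; rewrite /= inordK. Qed.
Lemma czE u : cz u = u ord0 2.
Proof. by congr (u _ _); apply/val_inj; rewrite /= inordK. Qed.

Lemma crossp0 u w : crossp u w ord0 0 = u ord0 1 * w ord0 2 - u ord0 2 * w ord0 1.
Proof. by rewrite mxE /= !cyE !czE. Qed.
Lemma crossp1 u w : crossp u w ord0 1 = u ord0 2 * w ord0 0 - u ord0 0 * w ord0 2.
Proof. by rewrite mxE /= !cxE !czE. Qed.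
Lemma crossp2 u w : crossp u w ord0 2 = u ord0 0 * w ord0 1 - u ord0 1 * w ord0 0.
Proof. by rewrite mxE /= !cxE !cyE. Qed.
Definition crosspE := (crossp0, crossp1, crossp2).

Lemma ord3P (Q : 'I_3 -> Prop) : Q 0 -> Q 1 -> Q 2 -> forall i, Q i.
Proof.
move=> q0 q1 q2 [[|[|[|//]]] h].
- by rewrite (_ : Ordinal h = 0) //; apply/val_inj.
- by rewrite (_ : Ordinal h = 1) //; apply/val_inj.
- by rewrite (_ : Ordinal h = 2) //; apply/val_inj.
Qed.

Lemma ord4P (Q : 'I_4 -> Prop) : Q 0 -> Q 1 -> Q 2 -> Q 3 -> forall i, Q i.
Proof.
move=> q0 q1 q2 q3 [[|[|[|[|//]]]] h].
- by rewrite (_ : Ordinal h = 0) //; apply/val_inj.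
- by rewrite (_ : Ordinal h = 1) //; apply/val_inj.
- by rewrite (_ : Ordinal h = 2) //; apply/val_inj.
- by rewrite (_ : Ordinal h = 3) //; apply/val_inj.
Qed.

Lemma dotpE u w : dotp u w =
  u ord0 0 * w ord0 0 + u ord0 1 * w ord0 1 + u ord0 2 * w ord0 2.
Proof. exact: sum_ord3. Qed.

(** The three cross products are the determinant times the dual basis of [u], [v], [w], so their
    components are the scaled coordinates of [evec R c] in that basis. *)
Lemma cramer3 u v w c : dotp u (crossp v w) *: evec R c =
  crossp v w ord0 c *: u + crossp w u ord0 c *: v + crossp u v ord0 c *: w.
Proof.
apply/rowP => j; rewrite dotpE.
by elim/ord3P: c; elim/ord3P: j; rewrite !crosspE !mxE -!val_eqE /=; ring.
Qed.

Lemma normp_neq0 u w : dotp u w != 0 -> normp u != 0.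
Proof.
apply: contraNneq => /eqP; rewrite sqrtr_eq0 !dotpE => h.
have h0 := sqr_ge0 (u ord0 0); have h1 := sqr_ge0 (u ord0 1).
have h2 := sqr_ge0 (u ord0 2).
have e0 : u ord0 0 ^+ 2 = 0 by lra.
have e1 : u ord0 1 ^+ 2 = 0 by lra.
have e2 : u ord0 2 ^+ 2 = 0 by lra.
by move/eqP: e0 e1 e2; rewrite !sqrf_eq0 => /eqP-> /eqP; rewrite sqrf_eq0 => /eqP->
  /eqP; rewrite sqrf_eq0 => /eqP->; rewrite !mul0r !addr0.
Qed.

End Vectors.

Section Det3.
Variable R : realType.

Lemma det3E (u v w : pt R) (M : 'M[R]_3) :
  (forall c, M 0 c = u ord0 c) -> (forall c, M 1 c = v ord0 c) ->
  (forall c, M 2 c = w ord0 c) -> \det M = dotp u (crossp v w).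
Proof.
move=> h0 h1 h2.
have e00 : lift (0 : 'I_3) (0 : 'I_2) = 1 by apply/val_inj.
have e01 : lift (0 : 'I_3) (1 : 'I_2) = 2 by apply/val_inj.
have e10 : lift (1 : 'I_3) (0 : 'I_2) = 0 by apply/val_inj.
have e11 : lift (1 : 'I_3) (1 : 'I_2) = 2 by apply/val_inj.
have e20 : lift (2 : 'I_3) (0 : 'I_2) = 0 by apply/val_inj.
have e21 : lift (2 : 'I_3) (1 : 'I_2) = 1 by apply/val_inj.
have det2 (N : 'M[R]_2) : \det N = N 0 0 * N 1 1 - N 0 1 * N 1 0.
  rewrite (expand_det_row _ 0) !big_ord_recl big_ord0 addr0 /cofactor !det_mx11 !mxE.
  rewrite /= addn0 expr0 expr1 mul1r mulN1r mulrN.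
  by congr (N _ _ * N _ _ - N _ _ * N _ _); apply/val_inj.
rewrite (expand_det_row _ 0) sum_ord3 /cofactor !det2 !mxE.
rewrite !(e00, e01, e10, e11, e20, e21) !h0 !h1 !h2 dotpE !crosspE /=.
by rewrite !addn0 !add0n expr0 expr1 /=; ring.
Qed.
End Det3.

Section Element.
Variables (R : realType) (K : finType) (P : K -> 'I_4 -> pt R).
Local Notation itri := (Rintegral (@leb2 R) (@tri_ref R)).
Local Notation itet := (Rintegral (@leb3 R) (@tet_ref R)).
Local Notation e1 k := (P k 1 - P k 0).
Local Notation e2 k := (P k 2 - P k 0).
Local Notation e3 k := (P k 3 - P k 0).

Lemma jacE k : jac P k = dotp (e1 k) (crossp (e2 k) (e3 k)).
Proof.
apply: det3E => c; rewrite mxE; congr ((P k _ - P k _) ord0 c); exact/val_inj.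
Qed.

Lemma fvertE k :
  [/\ [/\ fvert P k 0 0 = P k 1, fvert P k 0 1 = P k 2 & fvert P k 0 2 = P k 3],
      [/\ fvert P k 1 0 = P k 0, fvert P k 1 1 = P k 2 & fvert P k 1 2 = P k 3],
      [/\ fvert P k 2 0 = P k 0, fvert P k 2 1 = P k 1 & fvert P k 2 2 = P k 3] &
      [/\ fvert P k 3 0 = P k 0, fvert P k 3 1 = P k 1 & fvert P k 3 2 = P k 2]].
Proof. by split; split; congr (P k _); apply/val_inj. Qed.

(** The normalisation of the normal cancels the area factor, so no square root survives. *)
Lemma normal_fint k i (g : pt R -> R) c :
  let s := dotp (fcross P k i) (P k i - fvert P k i 0) in s != 0 ->
  normal P k i ord0 c * fint P k i g =
  - Num.sg s * fcross P k i ord0 c * itri (fun p => g (Defs.fmap P k i p)).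
Proof.
move=> s s0; rewrite /normal /fint mxE -/s; have n0 := normp_neq0 s0.
move: (Num.sg s) (normp _) (fcross P k i ord0 c) (Rintegral _ _ _) n0 => a n f I n0.
by field.
Qed.

(** The sign of each number decides which way [normal] points. It alternates because every face
    lists its vertices in increasing order. *)
Lemma face_volumes (p0 p1 p2 p3 : pt R) :
  let J := dotp (p1 - p0) (crossp (p2 - p0) (p3 - p0)) in
  [/\ dotp (crossp (p2 - p1) (p3 - p1)) (p0 - p1) = - J,
      dotp (crossp (p2 - p0) (p3 - p0)) (p1 - p0) = J,
      dotp (crossp (p1 - p0) (p3 - p0)) (p2 - p0) = - J &
      dotp (crossp (p1 - p0) (p2 - p0)) (p3 - p0) = J].
Proof. by split; rewrite !dotpE !crosspE !mxE; ring. Qed.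

(** The outward area vectors of a closed surface sum to zero. *)
Lemma face_crossp (p0 p1 p2 p3 : pt R) c :
  crossp (p2 - p1) (p3 - p1) ord0 c = crossp (p2 - p0) (p3 - p0) ord0 c
    + crossp (p3 - p0) (p1 - p0) ord0 c + crossp (p1 - p0) (p2 - p0) ord0 c.
Proof. by elim/ord3P: c; rewrite !crosspE !mxE; ring. Qed.

Lemma crosspC (u w : pt R) c : crossp u w ord0 c = - crossp w u ord0 c.
Proof. by elim/ord3P: c; rewrite !crosspE; ring. Qed.

Lemma fcrossE k (p := P k) :
  [/\ fcross P k 0 = crossp (p 2 - p 1) (p 3 - p 1),
      fcross P k 1 = crossp (p 2 - p 0) (p 3 - p 0),
      fcross P k 2 = crossp (p 1 - p 0) (p 3 - p 0) &
      fcross P k 3 = crossp (p 1 - p 0) (p 2 - p 0)].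
Proof.
have [[a1 a2 a3] [b1 b2 b3] [c1 c2 c3] [d1 d2 d3]] := fvertE k.
by rewrite /fcross a1 a2 a3 b1 b2 b3 c1 c2 c3 d1 d2 d3.
Qed.

Lemma fcross_dotp k i :
  dotp (fcross P k i) (P k i - fvert P k i 0) = (-1) ^+ (~~ odd i) * jac P k.
Proof.
have [[a1 _ _] [b1 _ _] [c1 _ _] [d1 _ _]] := fvertE k.
have [h0 h1 h2 h3] := fcrossE k.
have [v0 v1 v2 v3] := face_volumes (P k 0) (P k 1) (P k 2) (P k 3).
rewrite jacE; elim/ord4P: i.
- by rewrite a1 h0 v0 mulN1r.
- by rewrite b1 h1 v1 mul1r.
- by rewrite c1 h2 v2 mulN1r.
- by rewrite d1 h3 v3 mul1r.
Qed.

Lemma fcross_dotp_neq0 k i : jac P k != 0 ->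
  dotp (fcross P k i) (P k i - fvert P k i 0) != 0.
Proof. by rewrite fcross_dotp mulf_eq0 signr_eq0. Qed.

Lemma fmapE k (p : R * R) :
  [/\ Defs.fmap P k 0 p = vmap P k (1 - p.1 - p.2, p.1, p.2),
      Defs.fmap P k 1 p = vmap P k (0, p.1, p.2),
      Defs.fmap P k 2 p = vmap P k (p.1, 0, p.2) &
      Defs.fmap P k 3 p = vmap P k (p.1, p.2, 0)].
Proof.
have [[a1 a2 a3] [b1 b2 b3] [c1 c2 c3] [d1 d2 d3]] := fvertE k.
rewrite /Defs.fmap a1 a2 a3 b1 b2 b3 c1 c2 c3 d1 d2 d3 /vmap /=.
by split; apply/rowP => j; rewrite !mxE; ring.
Qed.

(** Expanded along the edges, the derivative has the constant coefficients [C1], [C2], [C3] divided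
    by [jac P k]. Up to sign these cross products are the area vectors of faces 1, 2, 3, so the
    reference theorem produces the normals. The first conjunct allows later integrals to be
    split. *)
Lemma vint_derive k (g : pt R -> R) c : jac P k != 0 -> polypt g ->
  btet (fun p => 'D_(evec R c) g (vmap P k p)) /\
  vint P k (fun x => 'D_(evec R c) g x) =
  \sum_i normal P k i ord0 c * fint P k i g.
Proof.
move=> J0 [pg dg].
have [Hx [Hy [Hz [[hx hy hz] [dx dy dz] [ix iy iz]]]]] :=
  tripoly_divergence (pg (P k 0) (e1 k) (e2 k) (e3 k)).
pose C1 := crossp (e2 k) (e3 k); pose C2 := crossp (e3 k) (e1 k).
pose C3 := crossp (e1 k) (e2 k).
have JD p : 'D_(evec R c) g (vmap P k p) = (jac P k)^-1 *
   (C1 ord0 c * Hx p.1.1 p.1.2 p.2 + C2 ord0 c * Hy p.1.1 p.1.2 p.2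
   + C3 ord0 c * Hz p.1.1 p.1.2 p.2).
  have D1 : 'D_(e1 k) g (vmap P k p) = Hx p.1.1 p.1.2 p.2.
    have -> : vmap P k p = (P k 0 + p.1.2 *: e2 k + p.2 *: e3 k) + p.1.1 *: e1 k.
      by rewrite /vmap (addrAC (P k 0)) (addrAC _ (p.1.1 *: _)).
    apply: (derive_line _ (dx p.1.1 p.1.2 p.2)) => s; congr g.
    by rewrite (addrAC (P k 0)) (addrAC _ (s *: _)).
  have D2 : 'D_(e2 k) g (vmap P k p) = Hy p.1.1 p.1.2 p.2.
    have -> : vmap P k p = (P k 0 + p.1.1 *: e1 k + p.2 *: e3 k) + p.1.2 *: e2 k.
      by rewrite /vmap (addrAC _ (p.1.2 *: _)).
    apply: (derive_line _ (dy p.1.1 p.1.2 p.2)) => s; congr g.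
    by rewrite (addrAC _ (s *: _)).
  have D3 : 'D_(e3 k) g (vmap P k p) = Hz p.1.1 p.1.2 p.2.
    by apply: (derive_line _ (dz p.1.1 p.1.2 p.2)) => s.
  (* Differentiability makes the derivative linear in the direction, and [cramer3] expands the
     multiple of [evec R c] in the edges. *)
  apply: (mulfI J0); rewrite mulrA mulfV// mul1r -D1 -D2 -D3 !deriveE//.
  have dZ (a : R) w x : a * 'd g x w = 'd g x (a *: w) by rewrite linearZ.
  by rewrite !dZ -!linearD jacE cramer3.
rewrite /vint.
have -> : (fun p => 'D_(evec R c) g (vmap P k p)) = fun p => (jac P k)^-1 *
   (C1 ord0 c * Hx p.1.1 p.1.2 p.2 + C2 ord0 c * Hy p.1.1 p.1.2 p.2
   + C3 ord0 c * Hz p.1.1 p.1.2 p.2) by apply/funext.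
have bZ (a : R) H : tripoly H -> btet (fun p => a * H p.1.1 p.1.2 p.2).
  by move=> hH; apply: bmfM; [exact: bmf_cst|exact: btet_tripoly].
have b12 : btet (fun p =>
    C1 ord0 c * Hx p.1.1 p.1.2 p.2 + C2 ord0 c * Hy p.1.1 p.1.2 p.2).
  by apply: bmfD; exact: bZ.
have bD : btet (fun p => C1 ord0 c * Hx p.1.1 p.1.2 p.2
   + C2 ord0 c * Hy p.1.1 p.1.2 p.2 + C3 ord0 c * Hz p.1.1 p.1.2 p.2).
  by apply: bmfD => //; exact: bZ.
split; first by apply: bmfM => //; exact: bmf_cst.
rewrite itetZ//.
rewrite itetD//; last exact: bZ.
rewrite itetD; [|exact: bZ..].
rewrite !itetZ; [|exact: btet_tripoly..].
(* The volume factor over the Jacobian is a sign, the one that also orients the normals. *)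
rewrite normrEsg mulrA -[Num.sg _ * _ / _]mulrA mulfV// mulr1 ix iy iz.
rewrite sum_ord4 !normal_fint; [|exact: fcross_dotp_neq0..].
have [[a1 _ _] [b1 _ _] [c1 _ _] [d1 _ _]] := fvertE k.
have [h0 h1 h2 h3] := fcrossE k.
have [v0 v1 v2 v3] := face_volumes (P k 0) (P k 1) (P k 2) (P k 3).
rewrite a1 b1 c1 d1 h0 h1 h2 h3 v0 v1 v2 v3 -jacE !sgrN.
(* Splitting the area vector of face 0 matches the three occurrences of [I0]. *)
rewrite (face_crossp (P k 0)) (crosspC (e1 k) (e3 k)) -/C1 -/C2 -/C3.
have f0 : (fun p => g (Defs.fmap P k 0 p)) = fun p => g (P k 0 + (1 - p.1 - p.2) *: e1 k
    + p.1 *: e2 k + p.2 *: e3 k).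
  by apply/funext => p; have [-> _ _ _] := fmapE k p.
have f1 : (fun p => g (Defs.fmap P k 1 p)) = fun p => g (P k 0 + 0 *: e1 k
    + p.1 *: e2 k + p.2 *: e3 k).
  by apply/funext => p; have [_ -> _ _] := fmapE k p.
have f2 : (fun p => g (Defs.fmap P k 2 p)) = fun p => g (P k 0 + p.1 *: e1 k
    + 0 *: e2 k + p.2 *: e3 k).
  by apply/funext => p; have [_ _ -> _] := fmapE k p.
have f3 : (fun p => g (Defs.fmap P k 3 p)) = fun p => g (P k 0 + p.1 *: e1 k
    + p.2 *: e2 k + 0 *: e3 k).
  by apply/funext => p; have [_ _ _ ->] := fmapE k p.
rewrite f0 f1 f2 f3; move: (Num.sg _) (C1 _ _) (C2 _ _) (C3 _ _) => s c1' c2' c3'.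
move: (Rintegral _ _ _) (Rintegral _ _ _) (Rintegral _ _ _) (Rintegral _ _ _).
by move=> I0 I1 I2 I3; ring.
Qed.

End Element.

(** * Independence of the vertex numbering *)

Section FaceInvariance.
Variable R : realType.
Local Notation itri := (Rintegral (@leb2 R) (@tri_ref R)).

Definition tri_cross (V : 'I_3 -> pt R) (a b c : 'I_3) :=
  crossp (V b - V a) (V c - V a).

Lemma ord3_perm_ind (Q : 'I_3 -> 'I_3 -> 'I_3 -> Prop) :
  Q 0 1 2 -> Q 0 2 1 -> Q 1 0 2 -> Q 1 2 0 -> Q 2 0 1 -> Q 2 1 0 ->
  forall a b c, a != b -> a != c -> b != c -> Q a b c.
Proof.
move=> q1 q2 q3 q4 q5 q6 a b c; rewrite -!val_eqE.
by elim/ord3P: a; elim/ord3P: b; elim/ord3P: c.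
Qed.

(** Renumbering the vertices changes the cross product by at most a sign. *)
Lemma dotp_tri_cross (V : 'I_3 -> pt R) (a b c : 'I_3) :
  a != b -> a != c -> b != c ->
  dotp (tri_cross V a b c) (tri_cross V a b c) =
  dotp (tri_cross V 0 1 2) (tri_cross V 0 1 2).
Proof.
move: a b c; apply: ord3_perm_ind; rewrite // !dotpE /tri_cross !crosspE !mxE; ring.
Qed.

Lemma tri_cross_degenerate (V : 'I_3 -> pt R) (a b c : 'I_3) :
  [|| a == b, a == c | b == c] -> tri_cross V a b c = 0.
Proof.
move=> h; apply/rowP => j; rewrite [RHS]mxE /tri_cross.
by move: h => /or3P[] /eqP->; elim/ord3P: j; rewrite !crosspE !mxE; ring.
Qed.

(** In barycentric form the six numberings differ by a permutation of the coordinates. The summand 0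
    is the base point [A] of [polypt]. *)
Lemma itri_tri_perm (V : 'I_3 -> pt R) (a b c : 'I_3) (g : pt R -> R) :
  polypt g -> a != b -> a != c -> b != c ->
  itri (fun p => g (V a + p.1 *: (V b - V a) + p.2 *: (V c - V a))) =
  itri (fun p => g (0 + p.1 *: V 0 + p.2 *: V 1 + (1 - p.1 - p.2) *: V 2)).
Proof.
move=> [hg _]; have hH := hg 0 (V 0) (V 1) (V 2).
have [p1 p2 p3] := itri_perm hH.
have p4 := itri_perm21 hH; have p5 := itri_perm32 hH.
move: a b c; apply: ord3_perm_ind;
  [rewrite -p2|rewrite -p3|rewrite -p5|rewrite -p1|idtac|rewrite -p4];
  congr Rintegral; apply/funext => p; congr g;
  by apply/rowP => j; rewrite !mxE; ring.
Qed.

(** Equal vertex sets only yield a map of indices; it is injective because a repeated vertex would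
    make the area of [W] vanish. *)
Lemma tri_integral_range (V W : 'I_3 -> pt R) (g : pt R -> R) : polypt g ->
  range V = range W -> normp (tri_cross W 0 1 2) != 0 ->
  normp (tri_cross V 0 1 2) *
    itri (fun p => g (V 0 + p.1 *: (V 1 - V 0) + p.2 *: (V 2 - V 0))) =
  normp (tri_cross W 0 1 2) *
    itri (fun p => g (W 0 + p.1 *: (W 1 - W 0) + p.2 *: (W 2 - W 0))).
Proof.
move=> hg VW W0.
have WV m : exists a, W m = V a.
  have : range W (W m) by exists m.
  by rewrite -VW => -[a _ <-]; exists a.
have [a Wa] := WV 0; have [b Wb] := WV 1; have [c Wc] := WV 2.
have Wabc : tri_cross W 0 1 2 = tri_cross V a b c by rewrite /tri_cross Wa Wb Wc.
have : ~~ [|| a == b, a == c | b == c].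
  apply: contra W0 => /(tri_cross_degenerate V) abc0.
  rewrite Wabc abc0 /normp (_ : dotp 0 0 = 0) ?sqrtr0//.
  by rewrite dotpE !mxE !mulr0 !addr0.
rewrite !negb_or => /and3P[ab ac bc].
have -> : normp (tri_cross W 0 1 2) = normp (tri_cross V 0 1 2).
  by rewrite Wabc /normp dotp_tri_cross.
rewrite Wa Wb Wc (@itri_tri_perm V a b c g hg ab ac bc).
by rewrite (@itri_tri_perm V 0 1 2 g hg isT isT isT).
Qed.

End FaceInvariance.

(** * Calculus of face and element integrals *)

Section Integrals.
Variables (R : realType) (K : finType) (P : K -> 'I_4 -> pt R).
Local Notation R1 := (measurableTypeR R).

Lemma fint_range k i k' j (g : pt R -> R) : polypt g -> jac P k' != 0 ->
  range (fvert P k i) = range (fvert P k' j) -> fint P k i g = fint P k' j g.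
Proof.
move=> hg J0 VW; apply: (tri_integral_range hg VW).
exact: normp_neq0 (fcross_dotp_neq0 j J0).
Qed.

Lemma btri_fmap k i (g : pt R -> R) : polypt g ->
  btri (fun p => g (Defs.fmap P k i p)).
Proof.
move=> [hg _].
rewrite (_ : (fun _ => _) = fun p => g (fvert P k i 0
   + p.1 *: (fvert P k i 1 - fvert P k i 0)
   + p.2 *: (fvert P k i 2 - fvert P k i 0) + p.2 *: 0)).
  exact: (bmf_tripoly (btri_fst R) (btri_snd R) (btri_snd R) (hg _ _ _ 0)).
by apply/funext => p; rewrite scaler0 addr0.
Qed.

Lemma btet_vmap k (g : pt R -> R) : polypt g -> btet (fun p => g (vmap P k p)).
Proof.
move=> [hg _].
exact: (bmf_tripoly (btet_1 R) (btet_2 R) (btet_3 R) (hg _ _ _ _)).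
Qed.

Lemma fintD k i f g : polypt f -> polypt g ->
  fint P k i (fun x => f x + g x) = fint P k i f + fint P k i g.
Proof.
by move=> hf hg; rewrite /fint itriD ?mulrDr//; exact: btri_fmap.
Qed.

Lemma fintZ k i (a : R) f : polypt f ->
  fint P k i (fun x => a * f x) = a * fint P k i f.
Proof.
by move=> hf; rewrite /fint itriZ 1?mulrCA//; exact: btri_fmap.
Qed.

Lemma fint_sum k i (I : Type) (s : seq I) (Q : pred I) F :
  (forall j, polypt (F j)) ->
  fint P k i (fun x => \sum_(j <- s | Q j) F j x) =
  \sum_(j <- s | Q j) fint P k i (F j).
Proof.
move=> hF; rewrite /fint itri_sum ?mulr_sumr// => j; exact: btri_fmap.
Qed.

Lemma fint_ge0 k i f : (forall x, 0 <= f x) -> 0 <= fint P k i f.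
Proof.
by move=> f0; rewrite mulr_ge0 ?sqrtr_ge0//; apply: Rintegral_ge0 => x _.
Qed.

Definition bvint k (f : pt R -> R) := btet (fun p => f (vmap P k p)).

Lemma bvintM k f g : bvint k f -> bvint k g -> bvint k (fun x => f x * g x).
Proof. exact: bmfM. Qed.

Lemma bvintZ k a f : bvint k f -> bvint k (fun x => a * f x).
Proof. by apply: bmfM; exact: bmf_cst. Qed.

Lemma bvint_sum k (I : Type) (s : seq I) (Q : pred I) F :
  (forall j, bvint k (F j)) -> bvint k (fun x => \sum_(j <- s | Q j) F j x).
Proof. by move=> hF; apply: (bmf_sum _ _ (F := fun j p => F j (vmap P k p))). Qed.

Lemma vintD k f g : bvint k f -> bvint k g ->
  vint P k (fun x => f x + g x) = vint P k f + vint P k g.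
Proof. by move=> hf hg; rewrite /vint itetD ?mulrDr. Qed.

Lemma vintZ k (a : R) f : bvint k f ->
  vint P k (fun x => a * f x) = a * vint P k f.
Proof. by move=> hf; rewrite /vint itetZ 1?mulrCA. Qed.

Lemma vint_sum k (I : Type) (s : seq I) (Q : pred I) F :
  (forall j, bvint k (F j)) ->
  vint P k (fun x => \sum_(j <- s | Q j) F j x) =
  \sum_(j <- s | Q j) vint P k (F j).
Proof. by move=> hF; rewrite /vint itet_sum ?mulr_sumr. Qed.

Lemma vint_le0 k f : bvint k f -> (forall x, f x <= 0) -> vint P k f <= 0.
Proof.
move=> bf f0; have /(vintZ (-1)) : bvint k (fun x => -1 * f x).
  by apply: bmfM => //; exact: bmf_cst.
rewrite (_ : (fun x => _) = f); last first.
  by apply/funext => x; rewrite mulrA mulN1r opprK mul1r.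
move=> ->; rewrite mulN1r oppr_le0 mulr_ge0//; apply: Rintegral_ge0 => p _.
by rewrite mulN1r oppr_ge0.
Qed.

(** Measurability is assumed in the product coordinates of [pt_of], so [vmap] is factored through
    its three affine, hence measurable, components. *)
Lemma bvint_bounded k (f : pt R -> R) (C : R) :
  measurable_fun [set: (R * R) * R] (fun p => f (pt_of p)) ->
  (forall x, `|f x| <= C) -> bvint k f.
Proof.
move=> mf fC; split; last by exists C => p _.
pose v c p := vmap P k p ord0 c : R.
have mv c : measurable_fun setT (v c : ((R1 * R1) * R1)%type -> R1).
  exact: (btet_vmap k (polypt_coord R c)).1.
have -> : (fun p => f (vmap P k p)) =
    (fun p => f (pt_of p)) \o (fun p => (v 0 p, v 1 p, v 2 p)).
  apply/funext => p /=; congr f; apply/rowP => j.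
  by elim/ord3P: j; rewrite [RHS]mxE.
apply: measurableT_comp; first exact: mf.
exact: (measurable_fun_pair (measurable_fun_pair (mv 0) (mv 1)) (mv 2)).
Qed.
End Integrals.

(** * Energy balance *)

Section Dotv.
Variables (R : realType) (n : nat).
Implicit Types u w : 'cV[R]_n.

Lemma dotvC u w : dotv u w = dotv w u.
Proof. by apply: eq_bigr => j _; rewrite mulrC. Qed.
Lemma dotvDl u u' w : dotv (u + u') w = dotv u w + dotv u' w.
Proof. by rewrite -big_split; apply: eq_bigr => j _; rewrite mxE mulrDl. Qed.
Lemma dotvZl a u w : dotv (a *: u) w = a * dotv u w.
Proof. by rewrite /dotv mulr_sumr; apply: eq_bigr => j _; rewrite mxE mulrA. Qed.
Lemma dotvNl u w : dotv (- u) w = - dotv u w.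
Proof. by rewrite -scaleN1r dotvZl mulN1r. Qed.
Lemma dotvDr u w w' : dotv u (w + w') = dotv u w + dotv u w'.
Proof. by rewrite dotvC dotvDl !(dotvC _ u). Qed.
Lemma dotvZr a u w : dotv u (a *: w) = a * dotv u w.
Proof. by rewrite dotvC dotvZl (dotvC _ u). Qed.
Lemma dotvNr u w : dotv u (- w) = - dotv u w.
Proof. by rewrite dotvC dotvNl (dotvC _ u). Qed.
Lemma sqn_ge0 u : 0 <= sqn u.
Proof. by apply: sumr_ge0 => j _; rewrite -expr2 sqr_ge0. Qed.

Definition dotvE := (dotvDl, dotvDr, dotvNl, dotvNr, dotvZl, dotvZr).
End Dotv.

Lemma dotv_mulmx (R : realType) (m n : nat) (A : 'M[R]_(m, n)) u w :
  dotv (A *m u) w = dotv u (A^T *m w).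
Proof.
rewrite /dotv; under eq_bigr => i _ do rewrite mxE mulr_suml.
rewrite exchange_big /=; apply: eq_bigr => j _; rewrite mxE mulr_sumr.
by apply: eq_bigr => i _; rewrite mxE mulrAC mulrC.
Qed.

Section PolyVec.
Variables (R : realType).

Definition polyvec m (f : pt R -> 'cV[R]_m) :=
  forall j, polypt (fun x => f x j ord0).

Lemma polyvecD m (f g : pt R -> 'cV[R]_m) :
  polyvec f -> polyvec g -> polyvec (fun x => f x + g x).
Proof.
move=> hf hg j; rewrite (_ : (fun _ => _) = fun x => f x j ord0 + g x j ord0).
  exact: polyptD.
by apply/funext => x; rewrite mxE.
Qed.

Lemma polyvecZ m a (f : pt R -> 'cV[R]_m) :
  polyvec f -> polyvec (fun x => a *: f x).
Proof.
move=> hf j; rewrite (_ : (fun _ => _) = fun x => a * f x j ord0).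
  exact: polyptZ.
by apply/funext => x; rewrite mxE.
Qed.

Lemma polyvecN m (f : pt R -> 'cV[R]_m) : polyvec f -> polyvec (fun x => - f x).
Proof.
move=> hf; rewrite (_ : (fun _ => _) = fun x => -1 *: f x); first exact: polyvecZ.
by apply/funext => x; rewrite scaleN1r.
Qed.

Lemma polyvec0 m : polyvec (fun=> 0 : 'cV[R]_m).
Proof. by move=> j; rewrite mxE; exact: polypt_cst. Qed.

Lemma polyvec_mulmx m n (A : 'M[R]_(m, n)) f :
  polyvec f -> polyvec (fun x => A *m f x).
Proof.
move=> hf j; rewrite (_ : (fun _ => _) = fun x => \sum_i A j i * f x i ord0).
  by apply: polypt_sum => i; exact: polyptZ.
by apply/funext => x; rewrite mxE.
Qed.

Lemma polypt_dotv m (f g : pt R -> 'cV[R]_m) :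
  polyvec f -> polyvec g -> polypt (fun x => dotv (f x) (g x)).
Proof. by move=> hf hg; apply: polypt_sum => j; exact: polyptM. Qed.

Lemma is_derive_bigsum (V : normedModType R) (I : Type) (s : seq I)
    (F : I -> V -> R) (x w : V) dF : (forall i, is_derive x w (F i) (dF i)) ->
  is_derive x w (fun y => \sum_(i <- s) F i y) (\sum_(i <- s) dF i).
Proof.
move=> hF; elim: s => [|i s IH].
  rewrite big_nil (_ : (fun _ => _) = cst 0); first exact: is_derive_cst.
  by apply/funext => y; rewrite big_nil.
rewrite big_cons (_ : (fun _ => _) = F i + (fun y => \sum_(i <- s) F i y)).
  exact: is_deriveD.
by apply/funext => y; rewrite big_cons.
Qed.

Lemma is_derive_cmul (V : normedModType R) (a : R) (f : V -> R) (x w : V) df :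
  is_derive x w f df -> is_derive x w (fun y => a * f y) (a * df).
Proof. exact: is_deriveZ. Qed.

Lemma is_derive_mulf (V : normedModType R) (f g : V -> R) (x w : V) df dg :
  is_derive x w f df -> is_derive x w g dg ->
  is_derive x w (fun y => f y * g y) (df * g x + f x * dg).
Proof.
move=> hf hg; have := is_deriveM hf hg; rewrite /GRing.scale /=.
by rewrite addrC [g x * _]mulrC.
Qed.

Lemma is_derive_coord (V : normedModType R) m (f : V -> 'cV[R]_m) (x w : V) j :
  derivable f x w -> is_derive x w (fun y => f y j ord0) (derive f x w j ord0).
Proof.
move=> df; apply: DeriveDef; first exact: (derivable_mxP _ _ _).1 df j ord0.
by rewrite derive_mx// mxE.
Qed.

(** The second term carries [A^T] so that, for [A = Ai R i], the two terms are the integrands of the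
    two volume terms of the scheme. *)
Lemma is_derive_dotv_mulmx (V : normedModType R) m n (A : 'M[R]_(m, n))
    (f : V -> 'cV[R]_n) (g : V -> 'cV[R]_m) (x w : V) :
  derivable f x w -> derivable g x w ->
  is_derive x w (fun y => dotv (A *m f y) (g y))
    (dotv (A *m derive f x w) (g x) + dotv (A^T *m derive g x w) (f x)).
Proof.
move=> df dg.
rewrite (_ : (fun _ => _) = fun y => \sum_i \sum_j A i j * (f y j ord0 * g y i ord0)).
  rewrite (_ : _ + _ = \sum_i \sum_j A i j * (derive f x w j ord0 * g x i ord0
     + f x j ord0 * derive g x w i ord0)).
    apply: is_derive_bigsum => i; apply: is_derive_bigsum => j.
    by apply: is_derive_cmul; apply: is_derive_mulf; exact: is_derive_coord.
  rewrite (dotv_mulmx A^T) trmxK (dotvC _ (A *m _)) -big_split /=.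
  apply: eq_bigr => i _.
  rewrite !mxE !mulr_suml -big_split; apply: eq_bigr => j _ /=.
  by rewrite mulrDr !mulrA.
apply/funext => y; apply: eq_bigr => i _; rewrite mxE mulr_suml.
by apply: eq_bigr => j _; rewrite mulrA.
Qed.

Lemma derivable_polyvec m (f : pt R -> 'cV[R]_m) x w : polyvec f -> derivable f x w.
Proof.
move=> hf; apply/derivable_mxP => i j; rewrite ord1.
exact/diff_derivable/(hf i).2.
Qed.

Lemma AnE (nu : pt R) : An nu = \sum_i nu ord0 i *: Ai R i.
Proof.
apply/matrixP => a b; rewrite sum_ord3 !mxE !cxE !cyE !czE !mxE -!val_eqE /=.
by case: a b => -[|[|[|[|[|[|[|//]]]]]]] ? -[[|[|[|[|[|[|//]]]]]] ?] /=; ring.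
Qed.
End PolyVec.

(** * Time derivative of the energy *)

Section Energy.
Variables (R : realType) (K : finType) (P : K -> 'I_4 -> pt R) (N m : nat).
Variable (Q : pt R -> 'M[R]_m).
Hypothesis bQ : forall k i j, bvint P k (fun x => Q x i j).

Definition vmass k (c d : midx N -> 'cV[R]_m) :=
  vint P k (fun x => dotv (Q x *m polyV c x) (polyV d x)).

(** The weights are the entries of the mass matrix of the monomial basis. They do not depend on the
    coefficients, which confines the time dependence to a finite sum of products. *)
Lemma vmassE k : exists W : midx N -> midx N -> 'I_m -> 'I_m -> R, forall c d,
  vmass k c d = \sum_a \sum_b \sum_i \sum_j W a b i j * (c a j ord0 * d b i ord0).
Proof.
(* Zero beyond total degree [N], so that sums range over all multi-indices. *)
pose mon (a : midx N) (x : pt R) : R := if (mdeg a <= N)%N then monom a x else 0.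
have hmon a : polypt (mon a).
  rewrite /mon; case: (mdeg a <= N)%N; last exact: polypt_cst.
  by apply: polypt_prod => i; exact: (polyptX (a i) (polypt_coord R i)).
have VE (c : midx N -> 'cV[R]_m) x j :
    polyV c x j ord0 = \sum_a mon a x * c a j ord0.
  rewrite /polyV summxE big_mkcond; apply: eq_bigr => a _.
  by rewrite /mon; case: ifP; rewrite ?mul0r// mxE.
pose f a b i j x := Q x i j * (mon a x * mon b x).
have bf a b i j : bvint P k (f a b i j).
  by apply: bvintM => //; apply: btet_vmap; exact: polyptM.
exists (fun a b i j => vint P k (f a b i j)) => c d.
rewrite /vmass (_ : (fun x => _) = fun x => \sum_a \sum_b \sum_i \sum_j
    (c a j ord0 * d b i ord0) * f a b i j x); last first.
  apply/funext => x; rewrite /dotv.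
  transitivity (\sum_i \sum_j \sum_a \sum_b (c a j ord0 * d b i ord0) * f a b i j x).
    apply: eq_bigr => i _; rewrite mxE mulr_suml; apply: eq_bigr => j _.
    rewrite !VE -mulrA mulr_suml mulr_sumr; apply: eq_bigr => a _.
    by rewrite !mulr_sumr; apply: eq_bigr => b _; rewrite /f; ring.
  under eq_bigr => i _ do rewrite exchange_big.
  rewrite exchange_big; apply: eq_bigr => a _.
  under eq_bigr => i _ do rewrite exchange_big.
  by rewrite exchange_big.
have bZ a b i j : bvint P k (fun x => (c a j ord0 * d b i ord0) * f a b i j x).
  exact: bvintZ.
rewrite vint_sum => [|a]; last by do 3 (apply: bvint_sum => ?); exact: bZ.
apply: eq_bigr => a _.
rewrite vint_sum => [|b]; last by do 2 (apply: bvint_sum => ?); exact: bZ.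
apply: eq_bigr => b _.
rewrite vint_sum => [|i]; last by apply: bvint_sum => ?; exact: bZ.
apply: eq_bigr => i _.
rewrite vint_sum => [|j]; last exact: bZ.
by apply: eq_bigr => j _; rewrite vintZ// mulrC.
Qed.

Lemma is_derive_vmass k (c : R -> midx N -> 'cV[R]_m) (t : R) :
  (forall a, derivable (fun s => c s a) t 1) ->
  let c' a := ddt (fun s => c s a) t in
  is_derive t (1 : R) (fun s => vmass k (c s) (c s))
    (vmass k c' (c t) + vmass k (c t) c').
Proof.
move=> dc c'; have [W WE] := vmassE k.
rewrite (_ : (fun s => _) = fun s => \sum_a \sum_b \sum_i \sum_j
  W a b i j * (c s a j ord0 * c s b i ord0)); last by apply/funext => s; rewrite WE.
rewrite (_ : _ + _ = \sum_a \sum_b \sum_i \sum_j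
  W a b i j * (c' a j ord0 * c t b i ord0 + c t a j ord0 * c' b i ord0)).
  apply: is_derive_bigsum => a; apply: is_derive_bigsum => b.
  apply: is_derive_bigsum => i; apply: is_derive_bigsum => j.
  apply: is_derive_cmul; apply: is_derive_mulf; exact: is_derive_coord.
rewrite !WE -big_split; apply: eq_bigr => a _ /=.
rewrite -big_split; apply: eq_bigr => b _ /=.
rewrite -big_split; apply: eq_bigr => i _ /=.
by rewrite -big_split; apply: eq_bigr => j _ /=; rewrite mulrDr.
Qed.

Lemma vmass_sym k c d : (forall x, (Q x)^T = Q x) -> vmass k c d = vmass k d c.
Proof.
move=> QT; congr vint; apply/funext => x.
by rewrite dotv_mulmx QT dotvC.
Qed.

(** Symmetry makes the two terms of the product rule equal; the resulting 2 meets the one half in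
    [E]. *)
Lemma is_derive_energy k (c : R -> midx N -> 'cV[R]_m) (t : R) :
  (forall x, (Q x)^T = Q x) -> (forall a, derivable (fun s => c s a) t 1) ->
  is_derive t (1 : R) (fun s => vmass k (c s) (c s))
    (2 * vmass k (fun a => ddt (fun s => c s a) t) (c t)).
Proof.
move=> QT dc; have /= := is_derive_vmass k dc.
by rewrite (vmass_sym k (c t) _ QT) -mulr2n mulr_natl.
Qed.

End Energy.

(** * Integration by parts for the coupled volume terms *)

Section Parts.
Variables (R : realType) (K : finType) (P : K -> 'I_4 -> pt R).

Lemma vint_parts k (tau : pt R -> 'cV[R]_7) (v : pt R -> 'cV[R]_6) :
  jac P k != 0 -> polyvec tau -> polyvec v ->
  vint P k (fun x => dotv (\sum_i Ai R i *m dxi v i x) (tau x)) +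
  vint P k (fun x => dotv (\sum_i (Ai R i)^T *m dxi tau i x) (v x)) =
  \sum_i fint P k i (fun x => dotv (An (normal P k i) *m v x) (tau x)).
Proof.
move=> J0 ht hv.
have dotv_suml n (F : 'I_3 -> 'cV[R]_n) w :
    dotv (\sum_i F i) w = \sum_i dotv (F i) w.
  by rewrite !sum_ord3 !dotvDl.
(* Derivatives must be integrable before sums are split; this is the first half of [vint_derive]. *)
have bdxi n (f : pt R -> 'cV[R]_n) i j : polyvec f ->
    bvint P k (fun x => dxi f i x j ord0).
  move=> hf; have [+ _] := vint_derive i J0 (hf j).
  rewrite /bvint; congr btet; apply/funext => p.
  by rewrite /dxi derive_mx ?mxE//; exact: derivable_polyvec.
have bdot n l (A : 'I_3 -> 'M[R]_(l, n)) f g : polyvec f -> polyvec g ->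
    bvint P k (fun x => dotv (\sum_i A i *m dxi f i x) (g x)).
  move=> hf hg; apply: bvint_sum => j; apply: bvintM; last exact: btet_vmap.
  rewrite (_ : (fun _ => _) = fun x => \sum_i \sum_s A i j s * dxi f i x s ord0).
    by apply: bvint_sum => i; apply: bvint_sum => s; apply: bvintZ; exact: bdxi.
  by apply/funext => x; rewrite summxE; apply: eq_bigr => i _; rewrite mxE.
pose F i x := dotv (Ai R i *m v x) (tau x).
have hF i : polypt (F i) by apply: polypt_dotv => //; exact: polyvec_mulmx.
rewrite -vintD; [|exact: bdot|exact: bdot].
rewrite (_ : (fun x => _) = fun x => \sum_i 'D_(evec R i) (F i) x); last first.
  apply/funext => x; rewrite !dotv_suml -big_split; apply: eq_bigr => i _ /=.
  by have [_ ->] := is_derive_dotv_mulmx (Ai R i)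
    (@derivable_polyvec _ _ v x (evec R i) hv)
    (@derivable_polyvec _ _ tau x (evec R i) ht).
rewrite vint_sum => [|i]; last by have [] := vint_derive i J0 (hF i).
transitivity (\sum_i \sum_f normal P k f ord0 i * fint P k f (F i)).
  by apply: eq_bigr => i _; have [_ ->] := vint_derive i J0 (hF i).
rewrite exchange_big; apply: eq_bigr => f _ /=.
rewrite [in RHS](_ : (fun x => _) = fun x => \sum_i normal P k f ord0 i * F i x).
  rewrite fint_sum => [|i]; last exact: polyptZ.
  by apply: eq_bigr => i _; rewrite fintZ.
apply/funext => x; rewrite AnE mulmx_suml dotv_suml.
by apply: eq_bigr => i _; rewrite -scalemxAl dotvZl.
Qed.

End Parts.

(** * Pairing the two sides of an interior face *)

Section Pairing.
Variables (R : realType) (K : finType) (P : K -> 'I_4 -> pt R).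
Variable nb : K -> 'I_4 -> fkind K.
Hypothesis mesh : conforming_mesh P nb.

(** Boundary faces are fixed points, which makes this an involution on all local faces and allows
    reindexing by it. *)
Definition mate (q : K * 'I_4) : K * 'I_4 :=
  if nb q.1 q.2 is FInt k j then (k, j) else q.

Lemma mateK : involutive mate.
Proof.
case: mesh => _ _ hint _ [k i]; rewrite /mate /=.
case E: (nb k i) => [k' j||] /=; rewrite ?E//.
by have [_ -> _ _] := hint _ _ _ _ E.
Qed.

(** [int_rep] selects the side of smaller rank; the remaining interior sides are the images of the
    selected ones under [mate]. *)
Lemma sum_interior_faces (phi : K -> 'I_4 -> R) :
  \sum_k \sum_(i | is_int (nb k i)) phi k i =
  \sum_k \sum_(i | int_rep nb k i) (phi k i + phi (mate (k, i)).1 (mate (k, i)).2).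
Proof.
case: (mesh) => _ _ hint _.
rewrite !pair_big_dep /=.
rewrite (bigID (fun q => int_rep nb q.1 q.2)) /= big_split /=; congr (_ + _).
  apply: eq_bigl => -[k i] /=; rewrite /int_rep.
  by case: (nb k i) => //= *; rewrite andbT.
rewrite (reindex_inj (inv_inj mateK)) /=.
apply: eq_big => [[k i]|[k i] _ //]; rewrite /int_rep /=.
case E: (nb k i) => [k' j||]; rewrite /mate /= ?E//.
(* The two ranks differ, since the neighbour is another element. *)
have [kk' E' _ _] := hint _ _ _ _ E; rewrite E' /= -leqNgt leq_eqVlt.
case: eqP => //= /ord_inj /enum_rank_inj [kE].
by rewrite kE eqxx in kk'.
Qed.

Lemma sum_face_kinds (phi : K -> 'I_4 -> R) :
  \sum_k \sum_i phi k i = \sum_k \sum_(i | int_rep nb k i)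
     (phi k i + phi (mate (k, i)).1 (mate (k, i)).2)
  + \sum_k \sum_(i | is_free (nb k i)) phi k i
  + \sum_k \sum_(i | is_abs (nb k i)) phi k i.
Proof.
rewrite -sum_interior_faces -!big_split; apply: eq_bigr => k _ /=.
rewrite [in RHS]big_mkcond [X in _ = _ + X + _]big_mkcond.
rewrite [X in _ = _ + X]big_mkcond /=.
rewrite -!big_split; apply: eq_bigr => i _ /=.
by case: (nb k i) => *; rewrite /= ?addr0 ?add0r.
Qed.
End Pairing.

(** * Numerical fluxes and their dissipation *)

Section Flux.
Variables (R : realType) (K : finType) (P : K -> 'I_4 -> pt R).
Variables (nb : K -> 'I_4 -> fkind K) (atau av : K -> 'I_4 -> R).
Variables (tau : K -> pt R -> 'cV[R]_7) (v : K -> pt R -> 'cV[R]_6).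
Hypotheses (mesh : conforming_mesh P nb).
Hypotheses (patau : face_param nb atau) (pav : face_param nb av).
Hypotheses (ptau : forall k, polyvec (tau k)) (pv : forall k, polyvec (v k)).
Local Notation A k i := (An (normal P k i)).

Definition flux_tau k i x :=
  dotv (2^-1 *: (A k i *m jv nb v k i x)
        + (atau k i / 2) *: (A k i *m jAtau P nb tau k i x))
       (tau k x).
Definition flux_v k i x :=
  dotv (2^-1 *: jAtau P nb tau k i x
        + (av k i / 2) *: ((A k i)^T *m (A k i *m jv nb v k i x)))
       (v k x).
(** The whole boundary integrand seen from one element: the first term is what [vint_parts] leaves,
    the others come from the scheme. *)
Definition flux k i x :=
  dotv (A k i *m v k x) (tau k x) + flux_tau k i x + flux_v k i x.

Lemma polyvec_jv k i : polyvec (jv nb v k i).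
Proof.
rewrite /jv; case: (nb k i) => [k' j||]; [|exact: polyvec0|exact: polyvecN].
by apply: polyvecD => //; exact: polyvecN.
Qed.

Lemma polyvec_jAtau k i : polyvec (jAtau P nb tau k i).
Proof.
rewrite /jAtau; case: (nb k i) => [k' j||].
- by apply: polyvec_mulmx; apply: polyvecD => //; exact: polyvecN.
- by apply: polyvecN; apply: polyvecZ; exact: polyvec_mulmx.
- by apply: polyvecN; exact: polyvec_mulmx.
Qed.

Lemma polypt_flux_tau k i : polypt (flux_tau k i).
Proof.
apply: polypt_dotv => //; apply: polyvecD; apply: polyvecZ; apply: polyvec_mulmx.
  exact: polyvec_jv.
exact: polyvec_jAtau.
Qed.

Lemma polypt_flux_v k i : polypt (flux_v k i).
Proof.
apply: polypt_dotv => //; apply: polyvecD; apply: polyvecZ.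
  exact: polyvec_jAtau.
by apply: polyvec_mulmx; apply: polyvec_mulmx; exact: polyvec_jv.
Qed.

Lemma polypt_flux0 k i : polypt (fun x => dotv (A k i *m v k x) (tau k x)).
Proof. by apply: polypt_dotv => //; exact: polyvec_mulmx. Qed.

Lemma polypt_flux k i : polypt (flux k i).
Proof.
apply: polyptD (polypt_flux_v k i); apply: polyptD (polypt_flux_tau k i).
exact: polypt_flux0.
Qed.

Lemma An_opp (n : pt R) : An (- n) = - An n.
Proof.
by rewrite !AnE -sumrN; apply: eq_bigr => i _; rewrite mxE scaleNr.
Qed.

(* The consistent parts of the two one-sided fluxes cancel; what remains is
   the dissipation of the penalty terms. *)
Lemma flux_interior k i x : int_rep nb k i ->
  flux k i x + flux (mate nb (k, i)).1 (mate nb (k, i)).2 x =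
  - (atau k i / 2 * sqn (jAtau P nb tau k i x)
     + av k i / 2 * sqn (A k i *m jv nb v k i x)).
Proof.
rewrite /int_rep /mate /=; case E: (nb k i) => [k' j||]//= _.
case: mesh => _ _ /(_ _ _ _ _ E)[_ E' _ nE] _.
rewrite /flux /flux_tau /flux_v /jAtau /jv E E' nE An_opp.
rewrite (patau.2 _ _ _ _ E) (pav.2 _ _ _ _ E) /sqn.
move: (An _) (atau k i) (av k i) (tau k x) (tau k' x) (v k x) (v k' x).
move=> B a b u u' w w'.
have -> : (- B)^T = - B^T by apply/matrixP => i1 i2; rewrite !mxE.
rewrite !mulNmx !mulmxN !dotvE !dotv_mulmx ?trmxK !mulmxBr !dotvE.
(* Adjointness and the symmetry of the products of [B] with its transpose bring all mixed terms to a
   common form, after which only scalar algebra remains. *)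
have adj y z : dotv y (B *m z) = dotv z (B^T *m y) by rewrite dotvC dotv_mulmx.
have symB : dotv u' (B *m (B^T *m u)) = dotv u (B *m (B^T *m u')).
  by rewrite adj [RHS]adj dotvC.
have symBT : dotv w' (B^T *m (B *m w)) = dotv w (B^T *m (B *m w')).
  by rewrite -!dotv_mulmx dotvC.
rewrite symB symBT (adj _ w) (adj _ w) (adj _ w') (adj _ w').
by field.
Qed.

(** Half of the doubled jump cancels the divergence term completely, and the same factor 2 turns the
    penalty weight [atau k i / 2] into [atau k i]. *)
Lemma flux_free k i x : is_free (nb k i) ->
  flux k i x = - (atau k i * sqn ((A k i)^T *m tau k x)).
Proof.
rewrite /flux /flux_tau /flux_v /jAtau /jv; case: (nb k i) => //= _.
rewrite /sqn !mulmx0 !scaler0 add0r addr0 !mulmxN -!scalemxAr !dotvE.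
rewrite !(dotv_mulmx _ _ (tau k x)).
by rewrite (dotvC ((A k i)^T *m tau k x) (v k x)); field.
Qed.

(** Each of the two equations cancels one half of the divergence term. *)
Lemma flux_abs k i x : is_abs (nb k i) ->
  flux k i x = - (atau k i / 2 * sqn ((A k i)^T *m tau k x)
                  + av k i / 2 * sqn (A k i *m v k x)).
Proof.
rewrite /flux /flux_tau /flux_v /jAtau /jv; case: (nb k i) => //= _.
rewrite /sqn !mulmxN !dotvE !(dotv_mulmx _ _ (tau k x)).
rewrite (dotv_mulmx (A k i)^T (A k i *m _)) trmxK.
by rewrite (dotvC ((A k i)^T *m tau k x) (v k x)); field.
Qed.

Lemma polypt_sqn m (f : pt R -> 'cV[R]_m) : polyvec f -> polypt (fun x => sqn (f x)).
Proof. by move=> hf; exact: polypt_dotv. Qed.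

Lemma fintN k i (f : pt R -> R) :
  polypt f -> fint P k i (fun x => - f x) = - fint P k i f.
Proof.
move=> hf; rewrite -mulN1r -fintZ//; congr fint; apply/funext => x.
by rewrite mulN1r.
Qed.

Lemma fint_mate k i (g : pt R -> R) : int_rep nb k i -> polypt g ->
  fint P (mate nb (k, i)).1 (mate nb (k, i)).2 g = fint P k i g.
Proof.
have -> : mate nb (k, i) = if nb k i is FInt k' j then (k', j) else (k, i) by [].
rewrite /int_rep; case E: (nb k i) => [k' j||]; [|by []|by []] => _ hg.
case: (mesh) => J0 _ /(_ _ _ _ _ E)[_ _ VW _] _.
by rewrite (fint_range hg (J0 k') VW).
Qed.

(** By [fint_mate] both one-sided integrals can be taken over the representative's parametrisation,
    so that the pointwise identity [flux_interior] applies. *)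
Lemma sum_flux :
  \sum_k \sum_i fint P k i (flux k i) =
  - (\sum_k \sum_(i | int_rep nb k i)
       fint P k i (fun x => atau k i / 2 * sqn (jAtau P nb tau k i x)
               + av k i / 2 * sqn (A k i *m jv nb v k i x)))
  - (\sum_k \sum_(i | is_free (nb k i))
       fint P k i (fun x => atau k i * sqn ((A k i)^T *m tau k x)))
  - (\sum_k \sum_(i | is_abs (nb k i))
       fint P k i (fun x => atau k i / 2 * sqn ((A k i)^T *m tau k x)
         + av k i / 2 * sqn (A k i *m v k x))).
Proof.
rewrite (sum_face_kinds mesh) -!sumrN; congr (_ + _ + _); apply: eq_bigr => k _;
  rewrite -sumrN; apply: eq_bigr => i hi.
- transitivity (fint P k i (fun x => flux k i x
      + flux (mate nb (k, i)).1 (mate nb (k, i)).2 x)).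
    have hmate := polypt_flux (mate nb (k, i)).1 (mate nb (k, i)).2.
    by rewrite (fint_mate hi hmate) (fintD P k i (polypt_flux k i) hmate).
  rewrite -fintN.
    by congr fint; apply/funext => x; exact: flux_interior.
  apply: polyptD; apply: polyptZ; apply: polypt_sqn; first exact: polyvec_jAtau.
  by apply: polyvec_mulmx; exact: polyvec_jv.
- rewrite -fintN; first by congr fint; apply/funext => x; exact: flux_free.
  by apply: polyptZ; apply: polypt_sqn; exact: polyvec_mulmx.
- rewrite -fintN; first by congr fint; apply/funext => x; exact: flux_abs.
  by apply: polyptD; apply: polyptZ; apply: polypt_sqn; exact: polyvec_mulmx.
Qed.

End Flux.

Lemma Dmat_le0 (R : realType) (eta : R) (kappa : 'I_3 -> R) (u : 'cV[R]_6) :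
  0 <= eta -> (forall i, 0 < kappa i) -> dotv u (Dmat eta kappa *m u) <= 0.
Proof.
move=> eta0 kappa0; apply: sumr_le0 => i _; rewrite mxE mulr_sumr.
apply: sumr_le0 => j _; rewrite mxE; case: ifP => [/andP[/eqP-> _]|]; last first.
  by rewrite mul0r mulr0.
rewrite mulrCA mulNr oppr_le0 mulr_ge0 ?divr_ge0//; first exact: ltW.
by rewrite -expr2 sqr_ge0.
Qed.

Theorem theorem1 (R : realType) (K : finType)
  (P : K -> 'I_4 -> pt R) (nb : K -> 'I_4 -> fkind K) (N : nat)
  (Qs : pt R -> 'M[R]_7) (Qv : pt R -> 'M[R]_6)
  (eta : R) (kappa : 'I_3 -> R) (atau av : K -> 'I_4 -> R)
  (ctau : R -> K -> midx N -> 'cV[R]_7) (cv : R -> K -> midx N -> 'cV[R]_6) :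
  (* Omega exactly triangulated by the affine simplicial mesh *)
  conforming_mesh P nb ->
  (* material matrices *)
  (forall x, (Qs x)^T = Qs x) -> (forall x, (Qv x)^T = Qv x) ->
  (forall x (u : 'cV[R]_7), u != 0 -> 0 < dotv u (Qs x *m u)) ->
  (forall x (u : 'cV[R]_6), u != 0 -> 0 < dotv u (Qv x *m u)) ->
  (exists C : R, forall x i j, `|Qs x i j| <= C /\ `|invmx (Qs x) i j| <= C) ->
  (exists C : R, forall x i j, `|Qv x i j| <= C /\ `|invmx (Qv x) i j| <= C) ->
  (forall i j, measurable_fun [set: (R * R) * R] (fun p => Qs (pt_of p) i j)) ->
  (forall i j, measurable_fun [set: (R * R) * R] (fun p => Qv (pt_of p) i j)) ->
  (* the damping matrix D *)
  0 <= eta -> (forall i, 0 < kappa i) ->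
  (* penalty parameters: nonnegative, piecewise constant on faces *)
  face_param nb atau -> face_param nb av ->
  (* tau_h, v_h in V_h^7, V_h^6, differentiable in t *)
  (forall t k a, derivable (fun s => ctau s k a) t 1) ->
  (forall t k a, derivable (fun s => cv s k a) t 1) ->
  let tau t k := polyV (ctau t k) in
  let v t k := polyV (cv t k) in
  let dtau t k := polyV (fun a => ddt (fun s => ctau s k a) t) in
  let dv t k := polyV (fun a => ddt (fun s => cv s k a) t) in
  (* semi-discrete DG formulation with f = 0 *)
  (forall t (ch : K -> midx N -> 'cV[R]_7),
     let h k := polyV (ch k) in
     \sum_k vint P k (fun x => dotv (Qs x *m dtau t k x) (h k x)) =
     \sum_k (vint P k (fun x => dotv (\sum_i @Ai R i *m dxi (v t k) i x) (h k x))
       + \sum_i fint P k i (fun x =>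
           dotv (2^-1 *: (An (normal P k i) *m jv nb (v t) k i x)
                 + (atau k i / 2) *: (An (normal P k i) *m jAtau P nb (tau t) k i x))
                (h k x)))) ->
  (forall t (cg : K -> midx N -> 'cV[R]_6),
     let g k := polyV (cg k) in
     \sum_k vint P k (fun x => dotv (Qv x *m dv t k x) (g k x)) =
     \sum_k (vint P k (fun x => dotv (\sum_i (@Ai R i)^T *m dxi (tau t k) i x) (g k x))
       + \sum_i fint P k i (fun x =>
           dotv (2^-1 *: jAtau P nb (tau t) k i x
                 + (av k i / 2) *: ((An (normal P k i))^T *m
                                     (An (normal P k i) *m jv nb (v t) k i x)))
                (g k x))
       + vint P k (fun x => dotv (Dmat eta kappa *m v t k x) (g k x)))) ->
  let E t := 2^-1 * \sum_k (vint P k (fun x => dotv (Qs x *m tau t k x) (tau t k x))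
                          + vint P k (fun x => dotv (Qv x *m v t k x) (v t k x))) in
  let rhs t :=
      - (\sum_k \sum_(i | int_rep nb k i)
           fint P k i (fun x => atau k i / 2 * sqn (jAtau P nb (tau t) k i x)
                   + av k i / 2 * sqn (An (normal P k i) *m jv nb (v t) k i x)))
      - (\sum_k \sum_(i | is_free (nb k i))
           fint P k i (fun x =>
             atau k i * sqn ((An (normal P k i))^T *m tau t k x)))
      - (\sum_k \sum_(i | is_abs (nb k i))
           fint P k i (fun x =>
             atau k i / 2 * sqn ((An (normal P k i))^T *m tau t k x)
             + av k i / 2 * sqn (An (normal P k i) *m v t k x)))
      + \sum_k vint P k (fun x => dotv (v t k x) (Dmat eta kappa *m v t k x)) in
  forall t : R, is_derive t 1 E (rhs t) /\ rhs t <= 0.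
Proof.
move=> mesh QsT QvT _ _ [Cs bQs] [Cv bQv] mQs mQv eta0 kappa0 patau pav dctau dcv.
move=> tau v dtau dv DGtau DGv E rhs t.
have J0 : forall k, jac P k != 0 by case: mesh.
have bs k i j : bvint P k (fun x => Qs x i j).
  by apply: (@bvint_bounded _ _ P k _ Cs) => // x; case: (bQs x i j).
have bv k i j : bvint P k (fun x => Qv x i j).
  by apply: (@bvint_bounded _ _ P k _ Cv) => // x; case: (bQv x i j).
have ptau k : polyvec (tau t k) by move=> j; exact: polypt_polyV.
have pv k : polyvec (v t k) by move=> j; exact: polypt_polyV.
have pD k : polypt (fun x => dotv (v t k x) (Dmat eta kappa *m v t k x)).
  by apply: polypt_dotv => //; exact: polyvec_mulmx.
have balance :
    \sum_k vint P k (fun x => dotv (Qs x *m dtau t k x) (tau t k x)) +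
    \sum_k vint P k (fun x => dotv (Qv x *m dv t k x) (v t k x)) = rhs t.
  rewrite (DGtau t (ctau t)) (DGv t (cv t)) -big_split /= /rhs.
  rewrite -(sum_flux mesh patau pav ptau pv) -big_split; apply: eq_bigr => k _ /=.
  have -> : vint P k (fun x => dotv (Dmat eta kappa *m v t k x) (v t k x)) =
      vint P k (fun x => dotv (v t k x) (Dmat eta kappa *m v t k x)).
    by congr vint; apply/funext => x; rewrite dotvC.
  (* The damping terms match; [addrACA] brings the two volume terms together for [vint_parts], and
     likewise the two face sums. *)
  rewrite addrA; congr (_ + _); rewrite addrACA (vint_parts (J0 k) (ptau k) (pv k)).
  rewrite -!big_split.
  apply: eq_bigr => i _ /=.
  rewrite -fintD; [|exact: polypt_flux_tau|exact: polypt_flux_v].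
  rewrite -fintD; last first.
  - by apply: polyptD; [exact: polypt_flux_tau|exact: polypt_flux_v].
  - exact: polypt_flux0.
  by congr fint; apply/funext => x; rewrite addrA.
split.
  rewrite -balance -big_split /=.
  (* Unfolding [tau] and [v], the integrals in [E] are [vmass] at the coefficient vectors. *)
  have dE k : is_derive t (1 : R) (fun s => vmass P Qs k (ctau s k) (ctau s k)
       + vmass P Qv k (cv s k) (cv s k))
      (2 * (vint P k (fun x => dotv (Qs x *m dtau t k x) (tau t k x)) +
            vint P k (fun x => dotv (Qv x *m dv t k x) (v t k x)))).
    rewrite mulrDr.
    exact: (is_deriveD (is_derive_energy bs k QsT (dctau t k))
                       (is_derive_energy bv k QvT (dcv t k))).
  have := is_derive_cmul 2^-1 (is_derive_bigsum (index_enum K) dE).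
  by rewrite -mulr_sumr mulrA mulVf ?mul1r ?pnatr_eq0.
have tau0 := patau.1; have v0 := pav.1.
have nneg (f g h : R) d :
    0 <= f -> 0 <= g -> 0 <= h -> d <= 0 -> - f - g - h + d <= 0.
  by move=> *; lra.
apply: nneg.
- apply: sumr_ge0 => k _; apply: sumr_ge0 => i _; apply: fint_ge0 => x.
  by rewrite addr_ge0// mulr_ge0 ?divr_ge0 ?sqn_ge0.
- apply: sumr_ge0 => k _; apply: sumr_ge0 => i _; apply: fint_ge0 => x.
  by rewrite mulr_ge0 ?sqn_ge0.
- apply: sumr_ge0 => k _; apply: sumr_ge0 => i _; apply: fint_ge0 => x.
  by rewrite addr_ge0// mulr_ge0 ?divr_ge0 ?sqn_ge0.
- apply: sumr_le0 => k _; apply: vint_le0 => [|x]; first exact: btet_vmap.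
  exact: Dmat_le0.
Qed.
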